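(* Let $S\ge1$ and let $X$ be a complete, separable geodesic space, not a singleton, which is $S$-concave and Busemann concave and has Hausdorff dimension $n$ (finite). Then, for every $0<\delta<1/2$, the set $X\setminus\mathcal A(1,\delta)$ is discrete. Furthermore, for every $0<\delta<1/2$ and each $k=1,\dots,n$, the Hausdorff dimension of $X\setminus\mathcal A(k,\delta,\delta)$ is at most $k-1$. In particular, $X$ admits a measure-theoretic stratification $\{X_k\}_{k=0}^n$ such that $X$ is the disjoint union of the strata $X_0,\dots,X_n$, with $\dim_H(X_k)\le k$ for each $k=0,\dots,n$. Moreover, the top-dimensional stratum $X_n$ is open and dense in $X$ and is a topological $n$-manifold, while the lowest-dimensional stratum $X_0$ is discrete.
   Context: Notation: $|xy|=\mathsf d(x,y)$. A constant-speed geodesic is a curve $\gamma:[0,1]\to X$ with $|\gamma(t)\gamma(s)|=|t-s|\,|\gamma(0)\gamma(1)|$; $X$ is geodesic if any two points are joined by one. $S$-concave ($S\ge1$): for every $p\in X$, every constant-speed geodesic $\gamma:[0,1]\to X$ and $t\in[0,1]$, $|p\gamma(t)|^2\ge(1-t)|p\gamma(0)|^2+t|p\gamma(1)|^2-St(1-t)|\gamma(0)\gamma(1)|^2$. Busemann concave: for any two constant-speed geodesics $\gamma,\eta:[0,1]\to X$ with $\gamma(0)=\eta(0)$, the function $t\mapsto|\gamma(t)\eta(t)|/t$ is non-increasing on $(0,1]$. Comparison angle: for $y,z\ne x$, $\tilde\angle yxz=\arccos\frac{|xy|^2+|xz|^2-|yz|^2}{2|xy||xz|}$. Error function: $\delta_S(s;t)=\arccos\left(1-\frac{(S-1)s}{2t}\right)$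 for $s,t>0$; an inequality involving $\delta_S(s;t)$ includes the requirement that it is defined. Strainers. Let $0<\delta,\alpha<1/2$. A point $p\neq x$ is a $(1,\delta)$-strainer at $x$ with opposite strainer $q\ne x$ if $|qx|<|px|$, $\delta_S(|qx|;|px|)<\delta$ and $\tilde\angle pxq>\pi-\delta$. For $k=1$ a $(1,\delta,\alpha)$-strainer means a $(1,\delta)$-strainer. For $k\ge2$, $(p_1,\dots,p_k)$ is a $(k,\delta,\alpha)$-strainer at $x$ with opposite strainer $(q_1,\dots,q_k)$ if: (1) $(p_1,\dots,p_{k-1})$ is a $(k-1,\delta,\alpha)$-strainer at $x$ with opposite strainer $(q_1,\dots,q_{k-1})$; (2) $p_k$ is a $(1,\delta)$-strainer at $x$ with $|q_{k-1}x|>|p_kx|$ and $\delta_S(|p_kx|;|q_{k-1}x|)<\delta$; (3) $q_k$ is an opposite strainer of $p_k$ at $x$ and $\tilde\angle p_ixp_k,\ \tilde\angle p_ixq_k,\ \tilde\angle q_ixp_k,\ \tilde\angle q_ixq_k>\pi/2-\alpha$ for all $i=1,\dots,k-1$. A point is $(k,\delta,\alpha)$-strained if it admits a $(k,\delta,\alpha)$-strainer at itself. $\mathcal A(k,\delta,\alpha)\subset X$ is the set of all $(k,\delta,\alpha)$-strained points; $\mathcal A(1,\delta)=\mathcal A(1,\delta,\alpha)$ is the set of all $(1,\delta)$-strained points. *)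

(* Defs.v *)
From HB Require Import structures.
From mathcomp Require Import all_boot all_order all_algebra.
From mathcomp Require Import all_classical all_reals all_analysis.

Set Implicit Arguments.
Unset Strict Implicit.
Unset Printing Implicit Defensive.

Import Order.TTheory GRing.Theory Num.Theory.
Import numFieldNormedType.Exports.

Local Open Scope classical_set_scope.
Local Open Scope ring_scope.

Section MetricGeometry.
Context {R : realType} {X : metricType R}.
Implicit Types (p q x y z : X) (A : set X) (delta alpha s t : R).

(* The library's [completeType] bundles a base point; this is its axiom. *)
Definition complete_space (Y : metricType R) : Prop :=
  forall F : set_system Y, ProperFilter F -> cauchy F -> exists y : Y, F --> y.

(* A curve [0,1] -> X is a function on R whose values outside [0,1] are never
   looked at. *)
Definition cs_geodesic (gamma : R -> X) : Prop :=
  forall s t, 0 <= s <= 1 -> 0 <= t <= 1 ->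
    mdist (gamma t) (gamma s) = `|t - s| * mdist (gamma 0) (gamma 1).

Definition comparison_angle y x z : R :=
  acos ((mdist x y ^+ 2 + mdist x z ^+ 2 - mdist y z ^+ 2)
        / (2 * mdist x y * mdist x z)).

(* delta_S(s;t) < d. The third clause says that the arccosine is defined:
   the library's [acos] is total, with junk values outside [-1,1]. *)
Definition error_lt (S s t d : R) : Prop :=
  let c := 1 - (S - 1) * s / (2 * t) in
  [/\ 0 < s, 0 < t, -1 <= c <= 1 & acos c < d].

(* p is a (1,delta)-strainer at x with opposite strainer q. *)
Definition strainer1 (S delta : R) x p q : Prop :=
  [/\ p != x, q != x, mdist q x < mdist p x,
      error_lt S (mdist q x) (mdist p x) delta
    & pi - delta < comparison_angle p x q].

(* (p_1,...,p_k) is a (k,delta,alpha)-strainer at x with opposite strainer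
   (q_1,...,q_k), where p_i is [p i.-1] and q_i is [q i.-1]; the values of p
   and q from index k on are irrelevant. The case k = 0 is a dummy value. *)
Fixpoint strainer (S delta alpha : R) (k : nat) x (p q : nat -> X) : Prop :=
  match k with
  | 0 => True
  | 1 => strainer1 S delta x (p 0%N) (q 0%N)
  | (j.+1 as k').+1 =>
    [/\ strainer S delta alpha k' x p q,
        mdist (p k') x < mdist (q j) x,
        error_lt S (mdist (p k') x) (mdist (q j) x) delta,
        strainer1 S delta x (p k') (q k')
      & forall i : nat, (i < k')%N ->
        [/\ pi / 2 - alpha < comparison_angle (p i) x (p k'),
            pi / 2 - alpha < comparison_angle (p i) x (q k'),
            pi / 2 - alpha < comparison_angle (q i) x (p k')
          & pi / 2 - alpha < comparison_angle (q i) x (q k')]]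
  end.

(* diam set0 = 0, whence the added point 0: the supremum of the empty set
   in \bar R is -oo. *)
Definition diam A : \bar R :=
  ereal_sup (0%E |` [set (mdist z.1 z.2)%:E | z in A `*` A]).

Definition hausdorff_premeasure (s eps : R) A : \bar R :=
  ereal_inf [set (\sum_(0 <= i <oo) (diam (U i) `^ s))%E | U in
    [set U : nat -> set X | A `<=` \bigcup_i U i /\
                            forall i, (diam (U i) <= eps%:E)%E]].

Definition hausdorff_measure s A : \bar R :=
  ereal_sup [set hausdorff_premeasure s eps A | eps in [set eps | 0 < eps]].

(* Only s > 0 is used, so that the convention for 0 `^ 0 plays no role; this
   does not change the infimum. The dimension of the empty set is 0. *)
Definition hausdorff_dim A : \bar R :=
  ereal_inf [set s%:E | s in
    [set s : R | 0 < s /\ hausdorff_measure s A = 0%E]].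

End MetricGeometry.

Definition geodesic_space {R : realType} (X : metricType R) : Prop :=
  forall x y : X, exists gamma : R -> X,
    [/\ cs_geodesic gamma, gamma 0 = x & gamma 1 = y].

Definition separable_space (T : topologicalType) : Prop :=
  exists2 D : set T, countable D & dense D.

Definition S_concave {R : realType} (S : R) (X : metricType R) : Prop :=
  forall (p : X) (gamma : R -> X) (t : R), cs_geodesic gamma -> 0 <= t <= 1 ->
    (1 - t) * mdist p (gamma 0) ^+ 2 + t * mdist p (gamma 1) ^+ 2
      - S * t * (1 - t) * mdist (gamma 0) (gamma 1) ^+ 2
    <= mdist p (gamma t) ^+ 2.

Definition Busemann_concave {R : realType} (X : metricType R) : Prop :=
  forall gamma eta : R -> X, cs_geodesic gamma -> cs_geodesic eta ->
    gamma 0 = eta 0 ->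
    forall s t : R, 0 < s -> s <= t -> t <= 1 ->
      mdist (gamma t) (eta t) / t <= mdist (gamma s) (eta s) / s.

Definition strained {R : realType} (X : metricType R) (S : R) (k : nat)
    (delta alpha : R) : set X :=
  [set x | exists p q : nat -> X, strainer S delta alpha k x p q].
Arguments strained {R} X S k delta alpha _.

Definition discrete_set (T : topologicalType) (A : set T) : Prop :=
  A `<=` isolated A.

Definition homeomorphic (T U : topologicalType) : Prop :=
  exists (f : T -> U) (g : U -> T),
    [/\ continuous f, continuous g, cancel f g & cancel g f].

(* A set [A] used as a type carries the subspace topology. *)
Definition locally_euclidean (R : realType) (n : nat) (M : topologicalType) :
    Prop :=
  forall x : M, exists (U : set M) (V : set 'rV[R]_n),
    [/\ open U, U x, open V & homeomorphic (set_type U) (set_type V)].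

Definition topological_manifold (R : realType) (n : nat)
    (M : topologicalType) : Prop :=
  [/\ hausdorff_space M, @second_countable M & locally_euclidean R n M].

(* Main.v *)
Require Import Defs.
From HB Require Import structures.
From mathcomp Require Import all_boot all_order all_algebra.
From mathcomp Require Import all_classical all_reals all_analysis.
From mathcomp Require Import ring lra.

Set Implicit Arguments.
Unset Strict Implicit.
Unset Printing Implicit Defensive.

Import Order.TTheory GRing.Theory Num.Theory.
Import numFieldNormedType.Exports.

Local Open Scope classical_set_scope.
Local Open Scope ring_scope.

(** Instead of tangent cones and spaces of directions, the proof uses explicit
    estimates at small scales.

    Comparison angles enter only through their cosines.  By [S]-concavity they
    are monotone along short geodesics up to an error ([slope_along]), so a
    distance [mdist p] grows almost at unit speed toward the opposite strainer
    [q], and [mdist q] grows almost at unit speed toward [p].  Concavity alone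
    bounds distances only from below.  The decisive upper bound is that
    [mdist p + mdist q] is nearly constant near a strained point
    ([sum_lipschitz]): a midpoint argument lets the small geodesic and the
    long one exchange their roles.  Hence a strainer of length [k] provides [k]
    pairs of directions in which its distance functions can be moved almost
    independently ([framed_exists]), and by successive correction the map made
    of these [k] distances is open, with a linear estimate ([framed_open]).

    Busemann concavity says that contracting toward a point shrinks separated
    sets no more than expected.  A large separated set therefore generates a
    Cantor set of large dimension, so finite Hausdorff dimension bounds the
    number of separated points in any ball, at every scale ([packing_bound]).
    There are two consequences.  An open map to [R ^ k] produces grids of
    separated points, so strainers longer than the dimension do not exist
    ([strainer_dim]).  And directions at a point are precompact
    ([direction_compact]): if points [z j] converge to [y], some [z j] lies
    almost on a geodesic from [y] to an earlier [z i], and so is strained by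
    [z i] and [y].

    Now let [E] be the set of points without strainer of length [k.+1] near a
    point with a strainer of length [k].  If the [k] distances did not separate
    a point of [E] from its neighbours in [E], precompactness of directions
    would yield a strainer of length [k.+1] at a point of [E].  So they are
    bi-Lipschitz coordinates on countably many pieces of [E], whose dimension
    is at most [k] ([unstrained_null]); for [k = 0] the points of [E] are
    isolated ([unstrained1_discrete]).  The constants deteriorate with each
    step, which is harmless because good constants may be required at the
    start: the sets of strained points grow with [delta].

    For [k = n] no longer strainers exist, so the open map given by a strainer
    of length [n] is also injective nearby: otherwise the end points of a short
    geodesic on which it is nearly constant would extend the strainer at a
    point of that geodesic ([strainer_injective]).  This gives the charts of
    the top stratum.  It is dense, since open sets have full dimension by
    contraction ([open_null_all]).  The strata are the successive differences
    of the sets of [k]-strained points for one small [delta]. *)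

(** * Comparison angles through their cosines *)

Section CosineForm.
Context {R : realType} {X : metricType R}.
Implicit Types (x y z a b : X) (p q : nat -> X).

Definition cosang a x b : R :=
  (mdist x a ^+ 2 + mdist x b ^+ 2 - mdist a b ^+ 2)
  / (2 * mdist x a * mdist x b).

Lemma cosang_bound a x b : a != x -> b != x -> -1 <= cosang a x b <= 1.
Proof.
move=> ax bx; have a0 : 0 < mdist x a by rewrite mdist_gt0 eq_sym.
have b0 : 0 < mdist x b by rewrite mdist_gt0 eq_sym.
have t1 := metric_triangle a x b; have t2 := metric_triangle x a b.
have t3 := metric_triangle x b a; have c0 := mdist_ge0 a b.
rewrite (metric_sym a x) in t1; rewrite (metric_sym b a) in t3.
have ab0 : 0 < 2 * mdist x a * mdist x b by rewrite !mulr_gt0.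
rewrite /cosang ler_pdivlMr// ler_pdivrMr//.
move: (mdist x a) (mdist x b) (mdist a b) a0 b0 t1 t2 t3 c0 {ab0} => u v w *.
by apply/andP; split; nra.
Qed.

Lemma comparison_angle_gt a x b (th : R) : a != x -> b != x -> 0 <= th <= pi ->
  (th < comparison_angle a x b) = (cosang a x b < cos th).
Proof.
move=> ax bx /andP[t0 tpi]; have cb := cosang_bound ax bx.
rewrite /comparison_angle -/(cosang a x b).
have [/andP[c0 cpi] {2}<-] := acos_def cb.
by rewrite ltr_cos // in_itv/= ?c0 ?t0.
Qed.

(** The strainer conditions with the angles replaced by their cosines: [kap]
    stands for [1 - cos delta] and [sig] for [sin alpha], and the recursion on
    the length is unfolded. *)
Definition strainer1_cos (S kap : R) x a b : Prop :=
  [/\ a != x, b != x, mdist b x < mdist a x,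
      (S - 1) * mdist b x < kap * (2 * mdist a x) & cosang a x b < -1 + kap].

Definition strainer_cos (S kap sig : R) (k : nat) x p q : Prop :=
  [/\ forall i, (i < k)%N -> strainer1_cos S kap x (p i) (q i),
      forall i, (i.+1 < k)%N -> mdist (p i.+1) x < mdist (q i) x /\
        (S - 1) * mdist (p i.+1) x < kap * (2 * mdist (q i) x)
    & forall i j, (i < j < k)%N ->
        [/\ cosang (p i) x (p j) < sig, cosang (p i) x (q j) < sig,
            cosang (q i) x (p j) < sig & cosang (q i) x (q j) < sig]].

Definition strained_cos (S kap sig : R) (k : nat) : set X :=
  [set x | exists p q, strainer_cos S kap sig k x p q].

Lemma error_ltP (S s t d : R) : 1 <= S -> 0 < s -> 0 < t -> 0 < d < 2^-1 ->
  error_lt S s t d <-> (S - 1) * s < (1 - cos d) * (2 * t).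
Proof.
move=> S1 s0 t0 /andP[d0 d1]; have t20 : 0 < 2 * t by rewrite mulr_gt0.
have pi2 := @pi_ge2 R.
have cd0 : 0 < cos d by apply: cos_gt0_pihalf; apply/andP; split; lra.
have q0 : 0 <= (S - 1) * s / (2 * t).
  by rewrite divr_ge0 ?mulr_ge0 ?subr_ge0// ltW.
rewrite -ltr_pdivrMr//; split=> [[_ _ cb]|cd].
  have [/andP[c0 cpi] cE] := acos_def cb.
  by rewrite -(@ltr_cos R) ?in_itv/= ?c0 ?cpi ?cE//; lra.
have cb : -1 <= 1 - (S - 1) * s / (2 * t) <= 1 by apply/andP; split; lra.
split=> //; have [/andP[c0 cpi] cE] := acos_def cb.
by rewrite -(@ltr_cos R) ?in_itv/= ?c0 ?cpi ?cE//; lra.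
Qed.

Lemma strainer1_cosP (S d : R) x a b : 1 <= S -> 0 < d < 2^-1 ->
  strainer1 S d x a b <-> strainer1_cos S (1 - cos d) x a b.
Proof.
move=> S1 d01; have /andP[d0 d1] := d01; have pi2 := @pi_ge2 R.
have cE : cos (pi - d) = -1 + (1 - cos d).
  by rewrite addrC cosDpi cosN; ring.
have dpi : 0 <= pi - d <= pi by apply/andP; split; lra.
split=> -[ax bx ba er an]; split=> //; have a0 : 0 < mdist a x by rewrite mdist_gt0.
all: have b0 : 0 < mdist b x by rewrite mdist_gt0.
- exact/(error_ltP S1 b0 a0 d01).
- by rewrite -cE -comparison_angle_gt.
- exact/(error_ltP S1 b0 a0 d01).
- by rewrite comparison_angle_gt// cE.
Qed.

Lemma strainerS (S d al : R) k x p q : (0 < k)%N ->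
  strainer S d al k.+1 x p q =
  [/\ strainer S d al k x p q,
      mdist (p k) x < mdist (q k.-1) x,
      error_lt S (mdist (p k) x) (mdist (q k.-1) x) d,
      strainer1 S d x (p k) (q k)
    & forall i, (i < k)%N ->
      [/\ pi / 2 - al < comparison_angle (p i) x (p k),
          pi / 2 - al < comparison_angle (p i) x (q k),
          pi / 2 - al < comparison_angle (q i) x (p k)
        & pi / 2 - al < comparison_angle (q i) x (q k)]].
Proof. by case: k. Qed.

Lemma strainer_cosP (S d al : R) k x p q : 1 <= S -> 0 < d < 2^-1 ->
  0 < al < 2^-1 ->
  strainer S d al k x p q <-> strainer_cos S (1 - cos d) (sin al) k x p q.
Proof.
move=> S1 d01 al01; have /andP[al0 al1] := al01; have pi2 := @pi_ge2 R.
have cE : cos (pi / 2 - al) = sin al.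
  by rewrite cosB cos_pihalf sin_pihalf; ring.
have api : 0 <= pi / 2 - al <= pi by apply/andP; split; lra.
elim: k => [|[_|k IH]]; first by split=> // _; split=> // i j; rewrite andbC.
  split=> [/strainer1_cosP-/(_ S1 d01) s|[/(_ 0%N isT) s _ _]].
    by split=> [[]//|//|i [|j]] //; rewrite andbC.
  exact/strainer1_cosP.
rewrite strainerS//; split.
  move=> [/IH [h1 h2 h3] pq er st ang].
  have st' := (strainer1_cosP x (p k.+1) (q k.+1) S1 d01).1 st.
  have [px qx _ _ _] := st'.
  split.
  - by move=> i; rewrite ltnS leq_eqVlt => /orP[/eqP->//|/h1].
  - move=> i; rewrite !ltnS leq_eqVlt => /orP[/eqP->|]; last by rewrite -ltnS; exact: h2.
    have q0 : q k != x by have [] := h1 k (ltnSn _).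
    by split=> //; apply/error_ltP => //; rewrite mdist_gt0.
  - move=> i j /andP[ij]; rewrite ltnS leq_eqVlt => /orP[/eqP jE|jk].
      have ik : (i < k.+1)%N by rewrite -jE.
      have [pi0 qi0 _ _ _] := h1 i ik; have := ang i ik.
      by rewrite jE !comparison_angle_gt// cE.
    by apply: h3; rewrite ij.
move=> [h1 h2 h3].
have [px qx _ _ _] := h1 k.+1 (ltnSn _).
have [pq er] := h2 k (ltnSn _).
have q0 : q k != x by have [] := h1 k (leqnSn _).
split=> //.
- apply/IH; split=> [i ik|i ik|i j /andP[ij jk]].
  + by apply: h1; rewrite ltnW.
  + by apply: h2; rewrite ltnW.
  + by apply: h3; rewrite ij ltnW.
- by apply/error_ltP => //; rewrite mdist_gt0.
- by apply/strainer1_cosP => //; exact: h1.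
- move=> i ik; have [pi0 qi0 _ _ _] := h1 i (leqW ik).
  rewrite !comparison_angle_gt// cE; apply: h3.
  by rewrite ltnSn andbT.
Qed.

Lemma strained_cosP (S d al : R) k : 1 <= S -> 0 < d < 2^-1 ->
  0 < al < 2^-1 ->
  strained X S k d al = strained_cos S (1 - cos d) (sin al) k.
Proof.
move=> S1 d01 al01; apply/seteqP; split=> x [p [q h]]; exists p, q.
all: exact/(strainer_cosP k x p q S1 d01 al01).
Qed.

Lemma strainer1_cosW (S kap kap' : R) x a b : kap <= kap' ->
  strainer1_cos S kap x a b -> strainer1_cos S kap' x a b.
Proof.
move=> kk [ax bx ba er an]; have a0 : 0 < mdist a x by rewrite mdist_gt0.
split=> //; last lra.
by apply: lt_le_trans er _; rewrite ler_wpM2r// mulr_ge0// ltW.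
Qed.

Lemma strainer_cosW (S kap kap' sig sig' : R) k x p q :
  kap <= kap' -> sig <= sig' ->
  strainer_cos S kap sig k x p q -> strainer_cos S kap' sig' k x p q.
Proof.
move=> kk ss [h1 h2 h3]; split=> [i /h1/(strainer1_cosW kk)//|i ik|i j /h3].
  have [? er] := h2 i ik; split=> //; apply: lt_le_trans er _.
  by rewrite ler_wpM2r// mulr_ge0// mdist_ge0.
by move=> [????]; split; lra.
Qed.

Lemma strained_cosS (S kap sig : R) k :
  strained_cos S kap sig k.+1 `<=` strained_cos S kap sig k.
Proof.
move=> x [p [q [h1 h2 h3]]]; exists p, q; split=> [i ik|i ik|i j /andP[ij jk]].
- by apply: h1; rewrite ltnW.
- by apply: h2; rewrite ltnW.
- by apply: h3; rewrite ij ltnW.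
Qed.

(** Seen from a point [a] at a much larger distance, the law of cosines reduces
    to the first variation: the cosine of the angle at [x] is about the rate
    at which the distance to [a] decreases toward [b]. *)
Lemma cosang_lt_of_slope a b x (c : R) : b != x -> a != x ->
  0 < c <= 1 -> mdist x b <= c * mdist x a ->
  mdist x a - mdist a b <= c * mdist x b -> cosang a x b <= 3 * c.
Proof.
move=> bx ax /andP[c0 c1] ba sl.
have a0 : 0 < mdist x a by rewrite mdist_gt0 eq_sym.
have b0 : 0 < mdist x b by rewrite mdist_gt0 eq_sym.
have t := metric_triangle a x b; rewrite (metric_sym a x) in t.
rewrite /cosang ler_pdivrMr ?mulr_gt0//.
have [u1 u2] : 0 <= mdist a b /\ 0 <= mdist x a by split; exact: mdist_ge0.
move: (mdist x a) (mdist x b) (mdist a b) a0 b0 ba sl t u1 u2 => u v w u0 v0 ba sl t u1 u2.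
have [uw|uw] := leP u w.
  have : u ^+ 2 <= w ^+ 2 by rewrite ler_sqr ?nnegrE// ltW.
  have : v * v <= v * (c * u) by rewrite ler_pM2l.
  have : 0 <= c * u * v by rewrite !mulr_ge0// ltW.
  lra.
have : (u - w) * (u + w) <= c * v * (u + w) by rewrite ler_wpM2r//; lra.
have : c * v * (u + w) <= c * v * (2 * u) by rewrite ler_wpM2l ?mulr_ge0//; [lra..|lra].
have : v * v <= v * (c * u) by rewrite ler_pM2l.
have : 0 <= c * u * v by rewrite !mulr_ge0// ltW.
lra.
Qed.

End CosineForm.

(** * Geodesics and the two concavity conditions *)

Lemma cs_geodesic_scale (R : realType) (X : metricType R) (g : R -> X) (a : R) :
  0 <= a <= 1 -> cs_geodesic g -> cs_geodesic (fun t => g (a * t)).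
Proof.
move=> /andP[a0 a1] gg s t /andP[s0 s1] /andP[t0 t1].
have aI (u : R) : 0 <= u -> u <= 1 -> 0 <= a * u <= 1.
  by move=> u0 u1; rewrite mulr_ge0//= mulr_ile1.
have I01 : (0 : R) <= (0 : R) <= (1 : R) by rewrite lexx ler01.
rewrite mulr0 mulr1 (gg _ _ (aI s s0 s1) (aI t t0 t1)).
have a01 : 0 <= a <= 1 by apply/andP.
rewrite (gg a 0 a01 I01) sub0r normrN -mulrBr normrM; ring.
Qed.

Section Geodesics.
Context {R : realType} {X : metricType R} {S : R}.
Hypothesis S_ge1 : 1 <= S.
Hypothesis X_geodesic : geodesic_space X.
Hypothesis X_concave : S_concave S X.
Hypothesis X_busemann : Busemann_concave X.
Implicit Types (x y z p q a b : X) (s t c : R).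

Definition geo x y : R -> X := sval (cid (X_geodesic x y)).

Lemma geoP x y : [/\ cs_geodesic (geo x y), geo x y 0 = x & geo x y 1 = y].
Proof. by rewrite /geo; case: cid. Qed.

Lemma geo_cs x y : cs_geodesic (geo x y). Proof. by have [] := geoP x y. Qed.
Lemma geo0 x y : geo x y 0 = x. Proof. by have [] := geoP x y. Qed.
Lemma geo1 x y : geo x y 1 = y. Proof. by have [] := geoP x y. Qed.

Lemma mdist_geo x y s t : 0 <= s <= 1 -> 0 <= t <= 1 ->
  mdist (geo x y s) (geo x y t) = `|s - t| * mdist x y.
Proof. by move=> s1 t1; rewrite geo_cs// geo0 geo1. Qed.

Lemma mdist_geol x y t : 0 <= t <= 1 -> mdist x (geo x y t) = t * mdist x y.
Proof.
move=> t1; rewrite -{1}(geo0 x y) mdist_geo// ?lexx ?ler01// sub0r normrN.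
by rewrite ger0_norm//; case/andP: t1.
Qed.

Lemma mdist_geor x y t : 0 <= t <= 1 ->
  mdist (geo x y t) y = (1 - t) * mdist x y.
Proof.
move=> t1; rewrite -{2}(geo1 x y) mdist_geo// ?lexx ?ler01// distrC.
by rewrite ger0_norm// subr_ge0; case/andP: t1.
Qed.

Lemma geo_busemann x y z s t : 0 < s -> s <= t -> t <= 1 ->
  s * mdist (geo x y t) (geo x z t) <= t * mdist (geo x y s) (geo x z s).
Proof.
move=> s0 st t1; have t0 := lt_le_trans s0 st.
have := X_busemann (geo_cs x y) (geo_cs x z) _ s0 st t1.
rewrite !geo0 => /(_ erefl).
by rewrite ler_pdivrMr// mulrAC ler_pdivlMr// mulrC (mulrC t).
Qed.

(** This is the Busemann condition at unit time.  Contraction toward a point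
    has a Lipschitz inverse, which is how configurations reappear at all
    smaller scales. *)
Lemma geo_contraction x y z t : 0 <= t <= 1 ->
  t * mdist y z <= mdist (geo x y t) (geo x z t).
Proof.
move=> /andP[t0 t1]; have [->|tn0] := eqVneq t 0; first by rewrite mul0r mdist_ge0.
have tp : 0 < t by rewrite lt_neqAle eq_sym tn0.
by have := geo_busemann x y z tp t1 (lexx _); rewrite !geo1 mul1r.
Qed.

(** [S]-concavity makes the comparison angle monotone up to an error: if its
    cosine at [g 0], corrected by the error, is at most [c], then the distance
    to [a] decreases along [g] at most with slope [c]. *)
Lemma slope_along (g : R -> X) a t c : cs_geodesic g -> 0 <= t <= 1 ->
  a != g 0 -> g 1 != g 0 -> c <= 1 ->
  cosang a (g 0) (g 1) + (S - 1) * mdist (g 0) (g 1) / (2 * mdist a (g 0)) <= c ->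
  mdist a (g 0) - c * (t * mdist (g 0) (g 1)) <= mdist a (g t).
Proof.
move=> gg t01 ax yx c1 hc; have sc := X_concave a gg t01.
have a0 : 0 < mdist a (g 0) by rewrite mdist_gt0.
have b0 : 0 < mdist (g 0) (g 1) by rewrite mdist_gt0 eq_sym.
have cN1 : -1 <= c.
  have /andP[h _] := cosang_bound ax yx; apply: le_trans h (le_trans _ hc).
  by rewrite lerDl divr_ge0 ?mulr_ge0 ?subr_ge0// ltW.
rewrite /cosang (metric_sym (g 0) a) in hc.
have f0 := mdist_ge0 a (g t); move: (mdist a (g t)) f0 sc => f f0 sc.
have e0 := mdist_ge0 a (g 1).
move: (mdist a (g 0)) (mdist (g 0) (g 1)) (mdist a (g 1)) a0 b0 hc e0 sc => u v e u0 v0 hc e0 sc.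
have /andP[t0 t1] := t01.
have hc' : u ^+ 2 + v ^+ 2 - e ^+ 2 + (S - 1) * v ^+ 2 <= 2 * u * v * c.
  have uv : 0 < 2 * u * v by rewrite !mulr_gt0.
  rewrite -(ler_pM2l uv) in hc; apply: le_trans hc.
  rewrite le_eqVlt; apply/orP; left; apply/eqP.
  by field; rewrite (gt_eqF u0) (gt_eqF v0).
have [neg|pos] := leP (u - c * (t * v)) 0; first exact: le_trans neg f0.
rewrite -ler_sqr ?nnegrE// ?(ltW pos)//.
have h1 : t * (u ^+ 2 + v ^+ 2 - e ^+ 2 + (S - 1) * v ^+ 2) <= t * (2 * u * v * c).
  by rewrite ler_wpM2l.
have c2 : c ^+ 2 <= S.
  apply: le_trans S_ge1; rewrite -real_normK ?num_real// expr_le1//.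
  by rewrite ler_norml cN1 c1.
have h2 : c ^+ 2 * (t * v) ^+ 2 <= S * (t * v) ^+ 2.
  by rewrite ler_wpM2r// sqr_ge0.
lra.
Qed.

Lemma midpoint_concave p x y :
  (mdist p x ^+ 2 + mdist p y ^+ 2) / 2 - S / 4 * mdist x y ^+ 2
  <= mdist p (geo x y (2^-1)) ^+ 2.
Proof.
have h : (0 : R) <= (2^-1 : R) <= (1 : R) by apply/andP; split; lra.
have := X_concave p (geo_cs x y) h; rewrite geo0 geo1; lra.
Qed.

(** Square roots taken in [midpoint_concave]. *)
Lemma midpoint_concave1 p x y e : 0 < mdist p (geo x y (2^-1)) ->
  S * mdist x y <= 4 * e * mdist p (geo x y (2^-1)) ->
  mdist p x + mdist p y <= 2 * mdist p (geo x y (2^-1)) + e * mdist x y.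
Proof.
move=> m0 he; have := midpoint_concave p x y.
have [d1 [d2 d3]] : 0 <= mdist p x /\ 0 <= mdist p y /\ 0 <= mdist x y.
  by rewrite !mdist_ge0.
move: (mdist p (geo x y _)) m0 he => m m0 he.
move: (mdist p x) (mdist p y) (mdist x y) d1 d2 d3 he => u v w u0 v0 w0 he h.
have hw : S * w * w <= 4 * e * m * w by rewrite ler_wpM2r.
have ew0 : 0 <= e * w.
  have : 0 <= S * w * w by rewrite !mulr_ge0// (le_trans ler01).
  rewrite -(pmulr_lge0 _ m0); lra.
have ew2 : 0 <= (e * w) ^+ 2 by rewrite sqr_ge0.
have uv2 : 0 <= (u - v) ^+ 2 by rewrite sqr_ge0.
rewrite -ler_sqr ?nnegrE; lra.
Qed.

(** ** A single strainer *)

Section OneStrainer.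
Variables (eta : R) (a b x : X).
Hypothesis eta01 : 0 < eta <= 2^-1.
Hypothesis st : strainer1_cos S (eta ^+ 2) x a b.

(** Here the geodesic from [x] to [b] is short compared to the distance of [a],
    so the concavity error is absorbed by [eta ^+ 2]. *)
Lemma slope_toward_opposite t : 0 <= t <= 1 ->
  mdist a x + (1 - 2 * eta ^+ 2) * (t * mdist x b) <= mdist a (geo x b t).
Proof.
move=> t01; have [ax bx ba er an] := st; have a0 : 0 < mdist a x by rewrite mdist_gt0.
have /andP[e0 e1] := eta01; have S1 := S_ge1.
have := @slope_along (geo x b) a t (-1 + 2 * eta ^+ 2) (geo_cs x b) t01.
rewrite geo0 geo1 => /(_ ax bx) h.
have : mdist a x - (-1 + 2 * eta ^+ 2) * (t * mdist x b) <= mdist a (geo x b t).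
  apply: h; first nra.
  have : (S - 1) * mdist x b / (2 * mdist a x) < eta ^+ 2.
    by rewrite ltr_pdivrMr ?mulr_gt0// (metric_sym x b).
  lra.
lra.
Qed.

(** Along the long geodesic from [x] to [a] the concavity error is too large
    to be used directly; the geodesic is first cut at distance
    [eta * mdist b x], where the triangle inequality still keeps the angle to
    [b] close to [pi]. *)
Lemma slope_toward_strainer t : 0 <= t <= 1 -> t * mdist x a <= eta * mdist b x ->
  mdist b x + (1 - (4 + S) * eta) * (t * mdist x a) <= mdist b (geo x a t).
Proof.
move=> /andP[t0 t1] ts; have [ax bx ba er an] := st.
have a0 : 0 < mdist x a by rewrite mdist_gt0 eq_sym.
have b0 : 0 < mdist b x by rewrite mdist_gt0.
have /andP[e0 e1] := eta01; have S1 := S_ge1.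
rewrite (metric_sym a x) in ba er.
pose tau := eta * mdist b x / mdist x a.
have tau0 : 0 < tau by rewrite divr_gt0// mulr_gt0.
have tau1 : tau <= 1.
  rewrite ler_pdivrMr// mul1r; apply: le_trans (ltW ba).
  by rewrite ler_piMl ?(ltW b0)//; lra.
have tau01 : 0 <= tau <= 1 by rewrite ltW.
have ttau : t <= tau by rewrite ler_pdivlMr.
have u01 : 0 <= t / tau <= 1.
  by rewrite divr_ge0 ?(ltW tau0)//= ler_pdivrMr// mul1r.
have gs := cs_geodesic_scale tau01 (geo_cs x a).
have := @slope_along _ b (t / tau) (-1 + (4 + S) * eta) gs u01.
have -> : tau * (t / tau) = t by field; rewrite gt_eqF.
rewrite mulr0 mulr1 geo0 mdist_geol//.
have tauE : tau * mdist x a = eta * mdist b x.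
  by rewrite /tau; field; rewrite gt_eqF.
have -> : t / tau * (tau * mdist x a) = t * mdist x a.
  by field; rewrite gt_eqF.
have tx : geo x a tau != x.
  by rewrite -mdist_gt0 metric_sym mdist_geol// mulr_gt0.
have [c1|c1 _] := leP (-1 + (4 + S) * eta) 1; last first.
  have := metric_triangle b (geo x a t) x.
  rewrite (metric_sym (geo x a t) x) mdist_geol; last by apply/andP.
  have : 0 <= ((4 + S) * eta - 2) * (t * mdist x a).
    by rewrite !mulr_ge0 ?(ltW a0)//; lra.
  lra.
move=> /(_ bx tx isT) h.
suff {}/h : cosang b x (geo x a tau) + (S - 1) * (tau * mdist x a) / (2 * mdist b x)
    <= -1 + (4 + S) * eta by lra.
rewrite tauE.
have -> : (S - 1) * (eta * mdist b x) / (2 * mdist b x) = (S - 1) * eta / 2.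
  by field; rewrite gt_eqF.
suff : cosang b x (geo x a tau) <= -1 + 4 * eta.
  have : 0 <= (S + 1) * eta by rewrite mulr_ge0//; lra.
  lra.
have t1' := metric_triangle b (geo x a tau) a.
have t2' := metric_triangle b x a.
have t3' := metric_triangle b x (geo x a tau).
rewrite mdist_geor// in t1'.
rewrite mdist_geol// tauE in t3'.
rewrite /cosang mdist_geol// tauE (metric_sym x b).
have w0 := mdist_ge0 b (geo x a tau).
rewrite /cosang (metric_sym a b) (metric_sym x b) in an.
rewrite mulrBl mul1r tauE in t1'.
rewrite ltr_pdivrMr ?mulr_gt0// in an.
rewrite ler_pdivrMr ?mulr_gt0//.
have ab0 := mdist_ge0 b a.
move: (mdist b (geo x a tau)) w0 t1' t3'; move: (mdist b a) ab0 t2' an.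
move: (mdist x a) (mdist b x) a0 b0 ba {er tau tau0 tau1 tau01 ttau u01 gs tauE tx h ts c1 t0 t1} => u v u0 v0 vu w w0 t2 an f f0 t1 t3.
(* an angle close to pi at x leaves the triangle x a b little excess *)
have ex : v + u - w <= 2 * eta ^+ 2 * v.
  have h1 : (v + u - w) * (v + u + w) <= eta ^+ 2 * (2 * u * v) by lra.
  have h2 : (v + u - w) * u <= (v + u - w) * (v + u + w).
    by rewrite ler_wpM2l//; lra.
  by rewrite -(ler_pM2r u0); lra.
have fl : v + eta * v - 2 * eta ^+ 2 * v <= f by lra.
have ev : 0 < eta * v by rewrite mulr_gt0.
have g0 : 0 <= v + eta * v - 2 * eta ^+ 2 * v.
  have : eta * (eta * v) <= 2^-1 * (eta * v) by rewrite ler_wpM2r// ltW.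
  lra.
have f2 : (v + eta * v - 2 * eta ^+ 2 * v) ^+ 2 <= f ^+ 2.
  by rewrite ler_sqr ?nnegrE//; lra.
have : 0 <= (2 * eta ^+ 2 * v) ^+ 2 by rewrite sqr_ge0.
have : eta * (eta * v ^+ 2 * eta) <= 2^-1 * (eta * v ^+ 2 * eta).
  by rewrite ler_wpM2r// ?mulr_ge0// ?sqr_ge0// ltW.
have : 0 <= eta * v ^+ 2 * eta by rewrite ?mulr_ge0// ?sqr_ge0// ltW.
lra.
Qed.

End OneStrainer.

End Geodesics.

(** * Strainers persist nearby *)

Section Nearby.
Context {R : realType} {X : metricType R}.
Implicit Types (x y z a b : X) (p q : nat -> X).

Lemma cvg_mdist a x : mdist a y @[y --> x] --> mdist a x.
Proof.
apply/cvgrPdist_lt => e e0; have := nbhsx_ballx x e e0.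
apply: filterS => y; rewrite ballEmdist/= => xy.
have t1 := metric_triangle a x y; have t2 := metric_triangle a y x.
rewrite (metric_sym y x) in t2.
by rewrite ltr_norml; apply/andP; split; lra.
Qed.

Lemma cvg_mdistl a x : mdist y a @[y --> x] --> mdist x a.
Proof.
rewrite metric_sym; under eq_fun do rewrite metric_sym; exact: cvg_mdist.
Qed.

Lemma cvg_cosang a b x : a != x -> b != x ->
  cosang a y b @[y --> x] --> cosang a x b.
Proof.
move=> ax bx; have a0 : mdist x a != 0 by rewrite gt_eqF// mdist_gt0 eq_sym.
have b0 : mdist x b != 0 by rewrite gt_eqF// mdist_gt0 eq_sym.
have ca : mdist y a @[y --> x] --> mdist x a by exact: cvg_mdistl.
have cb : mdist y b @[y --> x] --> mdist x b by exact: cvg_mdistl.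
rewrite /cosang; apply: cvgM.
  apply: cvgB; last exact: cvg_cst.
  by apply: cvgD; rewrite !expr2; under eq_fun do rewrite expr2; apply: cvgM.
apply: cvgV; first by rewrite !mulf_neq0// pnatr_eq0.
by apply: cvgM => //; apply: cvgM => //; exact: cvg_cst.
Qed.

Lemma near_cosang a b x (c : R) : a != x -> b != x -> cosang a x b < c ->
  \forall y \near x, cosang a y b < c.
Proof. by move=> ax bx; apply: cvgr_lt; exact: cvg_cosang. Qed.

Lemma near_mdist_neq a x : a != x -> \forall y \near x, a != y.
Proof.
rewrite -mdist_gt0 => ax; have : \forall y \near x, 0 < mdist a y by exact: cvgr_gt (@cvg_mdist a x) _ ax.
by apply: filterS => y; rewrite mdist_gt0.
Qed.

Lemma near_mdist_lt a b x (c d : R) : c * mdist a x < d * mdist b x ->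
  \forall y \near x, c * mdist a y < d * mdist b y.
Proof.
rewrite -subr_gt0 => h.
have cv : d * mdist b y - c * mdist a y @[y --> x] --> d * mdist b x - c * mdist a x.
  by apply: cvgB; (apply: cvgM; first exact: cvg_cst); exact: cvg_mdist.
have : \forall y \near x, 0 < d * mdist b y - c * mdist a y by exact: cvgr_gt cv _ h.
by apply: filterS => y; rewrite subr_gt0.
Qed.

Lemma near_mdist_nested a b x (S kap : R) :
  mdist a x < mdist b x /\ (S - 1) * mdist a x < kap * (2 * mdist b x) ->
  \forall y \near x,
    mdist a y < mdist b y /\ (S - 1) * mdist a y < kap * (2 * mdist b y).
Proof.
move=> [h1 h2]; rewrite mulrA in h2; have h3 := near_mdist_lt h2.
rewrite -[mdist a x]mul1r -[mdist b x]mul1r in h1.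
apply: filterS2 (near_mdist_lt h1) h3 => y.
by rewrite !mul1r mulrA.
Qed.

Lemma near_strainer1 (S kap : R) x a b : strainer1_cos S kap x a b ->
  \forall y \near x, strainer1_cos S kap y a b.
Proof.
move=> [ax bx ba er an].
apply: filterS3 (near_mdist_nested (conj ba er)) (near_cosang ax bx an)
  (filterI (near_mdist_neq ax) (near_mdist_neq bx)) => y [h1 h2] h3 [h4 h5].
by split.
Qed.

Lemma near_forall_lt (T : Type) (F : set_system T) k (P : nat -> T -> Prop) : Filter F ->
  (forall i, (i < k)%N -> \forall y \near F, P i y) ->
  \forall y \near F, forall i, (i < k)%N -> P i y.
Proof.
move=> FF; elim: k => [|k IH] h; first by apply: nearW.
have h1 := IH (fun i ik => h i (ltnW ik)).
apply: filterS2 h1 (h k (ltnSn _)) => y h1 h2 i.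
by rewrite ltnS leq_eqVlt => /orP[/eqP->//|/h1].
Qed.

Lemma near_strainer (S kap sig : R) k x p q : strainer_cos S kap sig k x p q ->
  \forall y \near x, strainer_cos S kap sig k y p q.
Proof.
move=> [h1 h2 h3].
have n1 : \forall y \near x, forall i, (i < k)%N -> strainer1_cos S kap y (p i) (q i).
  by apply: near_forall_lt => i ik; exact: near_strainer1 (h1 i ik).
have n2 : \forall y \near x, forall i, (i < k)%N -> (i.+1 < k)%N ->
    mdist (p i.+1) y < mdist (q i) y /\
        (S - 1) * mdist (p i.+1) y < kap * (2 * mdist (q i) y).
  apply: near_forall_lt => i ik; have [ik1|ik1] := ltnP i.+1 k.
    by apply: filterS (near_mdist_nested (h2 i ik1)) => y.
  by apply: nearW.
have n3 : \forall y \near x, forall j, (j < k)%N -> forall i, (i < j)%N ->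
        [/\ cosang (p i) y (p j) < sig, cosang (p i) y (q j) < sig,
            cosang (q i) y (p j) < sig & cosang (q i) y (q j) < sig].
  apply: near_forall_lt => j jk; apply: near_forall_lt => i ij.
  have [c1 c2 c3 c4] := h3 i j (introT andP (conj ij jk)).
  have [pj qj _ _ _] := h1 j jk; have [pi qi _ _ _] := h1 i (ltn_trans ij jk).
  apply: filterS3 (near_cosang pi pj c1) (near_cosang pi qj c2)
    (filterI (near_cosang qi pj c3) (near_cosang qi qj c4)) => y ? ? [].
  by split.
apply: filterS3 n1 n2 n3 => y m1 m2 m3; split => //.
- by move=> i ik; apply: m2 => //; exact: ltnW.
- by move=> i j /andP[ij jk]; exact: m3.
Qed.

Lemma strained_cos_open (S kap sig : R) k : open (strained_cos S kap sig k : set X).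
Proof.
rewrite openE => x [p [q h]]; apply: filterS (near_strainer h) => y.
by exists p, q.
Qed.

Lemma near_radius (P : X -> Prop) x : (\forall y \near x, P y) ->
  exists2 r : R, 0 < r & forall y, mdist x y < r -> P y.
Proof.
move=> /nbhs_ballP[r r0 h]; exists r => // y xy.
by apply: h; rewrite ballEmdist.
Qed.

Lemma uniform_radius k (P : nat -> R -> Prop) :
  (forall i, (i < k)%N -> exists2 r, 0 < r & forall r', 0 < r' <= r -> P i r') ->
  exists2 r, 0 < r & forall i, (i < k)%N -> forall r', 0 < r' <= r -> P i r'.
Proof.
elim: k => [|k IH] h; first by exists 1.
have [r1 r10 h1] := IH (fun i ik => h i (ltnW ik)).
have [r2 r20 h2] := h k (ltnSn _).
exists (Num.min r1 r2) => [|i ik r' /andP[r'0]].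
  by rewrite lt_min r10.
rewrite le_min => /andP[l1 l2]; move: ik; rewrite ltnS leq_eqVlt => /orP[/eqP->|ik].
  by apply: h2; rewrite r'0.
by apply: h1 => //; rewrite r'0.
Qed.

(** Each [p i] is farther away than all later strainers, and by a factor that
    absorbs the concavity error. *)
Lemma strainer_nested (S kap sig : R) k x p q i j : strainer_cos S kap sig k x p q ->
  1 <= S -> 0 <= kap -> (j < i < k)%N ->
  mdist (p i) x < mdist (q j) x /\ (S - 1) * mdist (p i) x < kap * (2 * mdist (q j) x).
Proof.
move=> [h1 h2 _] S1 kap0; elim: i => [|i IH]; first by rewrite ltn0.
rewrite ltnS leq_eqVlt => /andP[/orP[/eqP->|ji] ik]; first exact: h2.
have [l1 e1] : mdist (p i) x < mdist (q j) x /\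
    (S - 1) * mdist (p i) x < kap * (2 * mdist (q j) x).
  by apply: IH; rewrite ji ltnW.
have [_ _ l2 _ _] := h1 i (ltnW ik); have [l3 e3] := h2 i ik.
split; first lra.
apply: lt_le_trans e3 _; rewrite ler_wpM2l//; lra.
Qed.

End Nearby.

(** * The map of distances from a strainer *)

(** A strainer acts on the ball of radius [r] around [x] as a frame: it lies
    far away, moving toward [q i] or [p i] changes the [i]-th distance at
    almost full speed and hardly affects the earlier ones, and
    [mdist (p i) + mdist (q i)] is nearly constant.  Nothing is said about the
    effect on the later distances: the frame is triangular. *)
Definition framed {R : realType} {X : metricType R} (eps r : R) (k : nat)
    (x : X) (p q : nat -> X) : Prop :=
  [/\ forall i y, (i < k)%N -> mdist x y < r ->
        r <= eps * mdist (p i) y /\ r <= eps * mdist (q i) y,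
      forall i y z, (i < k)%N -> mdist x y < r -> mdist x z < r ->
        mdist (p i) z + mdist (q i) z - (mdist (p i) y + mdist (q i) y)
          <= eps * mdist y z
    & forall i y s, (i < k)%N -> 0 <= s -> mdist x y + s < r ->
        (exists z, [/\ mdist y z = s, mdist (p i) y + (1 - eps) * s <= mdist (p i) z
           & forall j, (j < i)%N -> `|mdist (p j) z - mdist (p j) y| <= eps * s]) /\
        (exists z, [/\ mdist y z = s, mdist (p i) z = mdist (p i) y - s
           & forall j, (j < i)%N -> `|mdist (p j) z - mdist (p j) y| <= eps * s])].

Lemma framed_le {R : realType} {X : metricType R} (eps r r' : R) k (x : X) p q :
  r' <= r -> framed eps r k x p q -> framed eps r' k x p q.
Proof.
move=> rr [h1 h2 h3]; split=> [i y ik xy|i y z ik xy xz|i y s ik s0 xys].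
- have [] := h1 i y ik (lt_le_trans xy rr).
  by move=> u1 u2; split; exact: le_trans rr _.
- by apply: h2 => //; exact: lt_le_trans rr.
- by apply: h3 => //; exact: lt_le_trans rr.
Qed.

Section Frames.
Context {R : realType} {X : metricType R} {S : R}.
Hypothesis S_ge1 : 1 <= S.
Hypothesis X_geodesic : geodesic_space X.
Hypothesis X_concave : S_concave S X.
Implicit Types (x y z a b : X) (p q : nat -> X).
Let gd := geo X_geodesic.

(** The heart of the matter: the two distances of a strainer have almost
    opposite derivatives.  Let [m] be the midpoint of [y] and [z], and let
    [mb] and [ma] be at distance [|yz| / th] from [m] toward [b] and [a].
    Seen from these, [y] and [z] are symmetric about [m] by [S]-concavity, so
    the triangle inequality between [mb] and [ma] leaves no room for
    [mdist a + mdist b] to grow from [y] to [m]; by concavity again it cannot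
    grow from [m] to [z] either. *)
Lemma sum_lipschitz_step (th : R) a b y z : 0 < th <= 2^-1 ->
  let m := gd y z 2^-1 in
  y != z -> strainer1_cos S (th ^+ 4) m a b ->
  mdist y z <= th ^+ 3 * mdist b m ->
  S * mdist y z <= 4 * th * mdist b m ->
  mdist a z + mdist b z - (mdist a y + mdist b y)
    <= (12 + 3 * S) * th * mdist y z.
Proof.
move=> /andP[th0 th1] m yz st h3 h4; have [am bm ba er an] := st.
have S1 := S_ge1.
have D0 : 0 < mdist y z by rewrite mdist_gt0.
have b1 : 0 < mdist b m by rewrite mdist_gt0.
have a1 : 0 < mdist a m by rewrite mdist_gt0.
have th2 : th ^+ 2 <= 2^-1.
  by rewrite expr2; nra.
have eta01 : 0 < th ^+ 2 <= 2^-1 by rewrite exprn_gt0.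
have e4 : th ^+ 4 = (th ^+ 2) ^+ 2 by rewrite -exprM.
rewrite e4 in st er an.
pose L := mdist y z / th.
have L0 : 0 < L by rewrite divr_gt0.
have LE : th * L = mdist y z by rewrite /L; field; rewrite gt_eqF.
have Lb : L <= th ^+ 2 * mdist b m.
  by rewrite ler_pdivrMr// mulrAC -exprSr.
have Lbm : L <= mdist b m.
  apply: le_trans Lb _; rewrite ler_piMl ?mdist_ge0//; lra.
have tb : 0 <= L / mdist m b <= 1.
  by rewrite (metric_sym m b) divr_ge0 ?(ltW L0) ?mdist_ge0//= ler_pdivrMr// mul1r.
have tbE : L / mdist m b * mdist m b = L.
  by rewrite (metric_sym m b); field; rewrite gt_eqF.
have ta : 0 <= L / mdist m a <= 1.
  rewrite (metric_sym m a) divr_ge0 ?(ltW L0) ?mdist_ge0//= ler_pdivrMr// mul1r.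
  exact: le_trans Lbm (ltW ba).
have taE : L / mdist m a * mdist m a = L.
  by rewrite (metric_sym m a); field; rewrite gt_eqF.
have := slope_toward_opposite S_ge1 X_geodesic X_concave eta01 st tb.
have := slope_toward_strainer S_ge1 X_geodesic X_concave eta01 st ta.
have := mdist_geol X_geodesic m b tb.
have := mdist_geol X_geodesic m a ta.
have := mdist_geor X_geodesic m a ta.
rewrite taE tbE mulrBl mul1r taE.
have mp := @midpoint_concave1 _ _ _ S_ge1 X_geodesic X_concave.
move: (geo X_geodesic m b _) => mb; move: (geo X_geodesic m a _) => ma.
move=> u1 u2 u3 /(_ Lb) u4 u5.
have S4 : S * mdist y z <= 4 * (S * th / 4) * L.
  by rewrite -LE; move: (L) => L1; lra.
have v1 := mp mb y z (S * th / 4); have v2 := mp ma y z (S * th / 4).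
rewrite -/gd -/m (metric_sym mb m) u3 in v1.
rewrite -/gd -/m (metric_sym ma m) u2 in v2.
have {v1} := v1 L0 S4; have {v2} := v2 L0 S4.
have v3 := mp a y z th; have v4 := mp b y z th.
rewrite -/gd -/m in v3 v4.
have {v4} := v4 b1 h4.
have {v3} : mdist a y + mdist a z <= 2 * mdist a m + th * mdist y z.
  apply: v3 => //; apply: le_trans h4 _; rewrite ler_wpM2l// ?ltW//.
  by rewrite mulr_gt0.
have := metric_triangle a mb ma; have := metric_triangle a y mb.
have := metric_triangle b y ma; have := metric_triangle mb z ma.
have := metric_triangle a ma mb.
rewrite (metric_sym ma a) in u1 *.
rewrite (metric_sym y mb) (metric_sym y ma) (metric_sym z ma) (metric_sym ma mb).
rewrite (metric_sym m a) in u1.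
have th2' : th ^+ 2 <= 4^-1.
  have : th * th <= 2^-1 * 2^-1 by rewrite ler_pM// ltW.
  by rewrite expr2; lra.
have th3 : (th ^+ 2) ^+ 2 * L <= th / 4 * mdist y z.
  rewrite -LE; have : th ^+ 2 * (th ^+ 2 * L) <= 4^-1 * (th ^+ 2 * L).
    by rewrite ler_wpM2r// mulr_ge0 ?sqr_ge0// ltW.
  by move: (L) => L1; lra.
have th2L : th ^+ 2 * L = th * mdist y z by rewrite -LE; ring.
move: u1 u4 u5 th3 th2L; move: (L) => L1; move=> *.
have ? : S * (th ^+ 2 * L1) = S * (th * mdist y z) by congr (_ * _).
lra.
Qed.

Lemma sum_lipschitz (th : R) x a b : 0 < th <= 2^-1 ->
  strainer1_cos S (th ^+ 4) x a b ->
  exists2 r, 0 < r & forall y z, mdist x y < r -> mdist x z < r ->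
    mdist a z + mdist b z - (mdist a y + mdist b y)
      <= (12 + 3 * S) * th * mdist y z.
Proof.
move=> th01 st; have [ax bx _ _ _] := st; have S1 := S_ge1.
have /andP[th0 th1] := th01.
have [r0 r00 h0] := near_radius (near_strainer1 st).
have b0 : 0 < mdist b x by rewrite mdist_gt0.
pose c := Num.min (th ^+ 3 / 8) (th / S).
have S0 : 0 < S by lra.
have c0 : 0 < c by rewrite lt_min !divr_gt0// exprn_gt0.
exists (Num.min (r0 / 2) (Num.min (mdist b x / 4) (c * mdist b x))).
  by rewrite !lt_min !divr_gt0//= mulr_gt0.
move=> y z; rewrite !lt_min => /and3P[y1 y2 y3] /and3P[z1 z2 z3].
have [->|yz] := eqVneq y z; first by rewrite subrr mdistxx mulr0.
have half : 0 <= (2^-1 : R) <= 1 by apply/andP; split; lra.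
have d1 := mdist_geol X_geodesic y z half.
have D := metric_triangle y x z; rewrite (metric_sym y x) in D.
have t1 := metric_triangle x y (gd y z 2^-1).
have t2 := metric_triangle b (gd y z 2^-1) x.
rewrite (metric_sym (gd y z 2^-1) x) in t2; rewrite -/gd in d1.
have Dc : mdist y z <= 2 * c * mdist b x by lra.
have bm : mdist b x <= 2 * mdist b (gd y z 2^-1) by lra.
have Dc2 : mdist y z <= 4 * c * mdist b (gd y z 2^-1).
  apply: le_trans Dc _; have : c * mdist b x <= c * (2 * mdist b (gd y z 2^-1)).
    by rewrite ler_pM2l.
  lra.
have bm0 := mdist_ge0 b (gd y z 2^-1).
apply: sum_lipschitz_step => //.
- by apply: h0; lra.
- apply: le_trans Dc2 _; rewrite ler_wpM2r//.
  have : c <= th ^+ 3 / 8 by rewrite ge_min lexx.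
  have : 0 <= th ^+ 3 by rewrite exprn_ge0// ltW.
  lra.
- have : S * mdist y z <= S * (4 * c * mdist b (gd y z 2^-1)).
    by rewrite ler_wpM2l//; lra.
  have : (S * c) * mdist b (gd y z 2^-1) <= th * mdist b (gd y z 2^-1).
    rewrite ler_wpM2r// mulrC -ler_pdivlMr; last lra.
    by rewrite ge_min lexx orbT.
  lra.
Qed.

(** Moving toward a later strainer point hardly changes [mdist a]: concavity
    bounds the decrease of [mdist a] and of [mdist a'], and their sum is nearly
    constant. *)
Lemma cross_slope (kap sig : R) (t : R) a a' y b (c : R) :
  0 <= t <= 1 -> a != y -> a' != y -> b != y -> sig + kap <= 1 ->
  cosang a y b < sig -> cosang a' y b < sig ->
  (S - 1) * mdist b y < kap * (2 * mdist a y) ->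
  (S - 1) * mdist b y < kap * (2 * mdist a' y) ->
  mdist a (gd y b t) + mdist a' (gd y b t) - (mdist a y + mdist a' y)
    <= c * (t * mdist y b) ->
  0 <= sig + kap -> 0 <= c ->
  `|mdist a (gd y b t) - mdist a y| <= (sig + kap + c) * (t * mdist y b).
Proof.
move=> t01 ay a'y bY sk1 an an' er er' hc sk0 c0.
have S1 := S_ge1; have gs := geo_cs X_geodesic y b.
have sl e : e != y -> cosang e y b < sig -> (S - 1) * mdist b y < kap * (2 * mdist e y) ->
    mdist e y - (sig + kap) * (t * mdist y b) <= mdist e (gd y b t).
  move=> ey ane ere.
  have := @slope_along _ _ _ S_ge1 X_concave (gd y b) e t (sig + kap) gs t01.
  rewrite /gd geo0 geo1; apply => //.
  have e0 : 0 < mdist e y by rewrite mdist_gt0.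
  have : (S - 1) * mdist y b / (2 * mdist e y) < kap.
    by rewrite ltr_pdivrMr ?mulr_gt0// metric_sym.
  by move=> h; apply: ltW; rewrite ltrD.
have l1 := sl a ay an er; have l2 := sl a' a'y an' er'.
have s0 : 0 <= c * (t * mdist y b).
  by rewrite !mulr_ge0 ?mdist_ge0//; case/andP: t01.
by rewrite ler_norml; apply/andP; split; lra.
Qed.

(** All strainer conditions are open, hence hold on a ball.  They control the
    [i]-th distance ([slope_toward_opposite]) and the earlier ones
    ([cross_slope]); the latter is possible because the strainers are nested:
    later ones lie much closer to [x], so that geodesics toward them are short
    as seen from the earlier ones. *)
Lemma framed_exists (eps : R) : 0 < eps <= 1 ->
  exists kap sig : R, [/\ 0 < kap, 0 < sig &
  forall k x p q, strainer_cos S kap sig k x p q ->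
    exists r : R, [/\ 0 < r, framed eps r k x p q &
      forall y, mdist x y < r -> strainer_cos S kap sig k y p q]].
Proof.
move=> /andP[eps0 eps1]; have S1 := S_ge1.
pose th := Num.min 2^-1 (eps / (4 * (12 + 3 * S))).
have C0 : 0 < 4 * (12 + 3 * S) by lra.
have th0 : 0 < th by rewrite lt_min invr_gt0 ltr0n/= divr_gt0.
have th1 : th <= 2^-1 by rewrite ge_min lexx.
have thC : (12 + 3 * S) * th <= eps / 4.
  have : th <= eps / (4 * (12 + 3 * S)) by rewrite ge_min lexx orbT.
  rewrite ler_pdivlMr//; lra.
have th01 : 0 < th <= 2^-1 by rewrite th0.
have the : th <= eps / 4.
  apply: le_trans thC; rewrite ler_peMl// ?ltW//; lra.
pose kap := th ^+ 4; pose sig := eps / 4.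
have kap0 : 0 < kap by rewrite exprn_gt0.
have kape : 2 * kap <= eps / 4.
  have : th ^+ 3 <= 2^-1 by rewrite !exprS expr0; nra.
  have : th * th ^+ 3 <= th * 2^-1 -> 2 * kap <= eps / 4.
    by rewrite /kap (exprS th 3); lra.
  by move=> h h1; apply: h; rewrite ler_pM2l.
exists kap, sig; split=> //; first by rewrite divr_gt0.
move=> k x p q st; have [h1 h2 h3] := st.
have [r1 r10 near1] := near_radius (near_strainer st).
have [r2 r20 near2] : exists2 r, 0 < r & forall i, (i < k)%N -> forall r', 0 < r' <= r ->
    forall y z, mdist x y < r' -> mdist x z < r' ->
    mdist (p i) z + mdist (q i) z - (mdist (p i) y + mdist (q i) y)
      <= (12 + 3 * S) * th * mdist y z.
  apply: uniform_radius => i ik; have [r r0 h] := sum_lipschitz th01 (h1 i ik).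
  exists r => // r' /andP[_ rr] y z xy xz.
  by apply: h; exact: lt_le_trans rr.
have [r3 r30 near3] : exists2 r, 0 < r & forall i, (i < k)%N -> forall r', 0 < r' <= r ->
    forall y, mdist x y < r' -> r' <= eps * mdist (p i) y /\ r' <= eps * mdist (q i) y.
  apply: uniform_radius => i ik.
  have [px qx qp _ _] := h1 i ik.
  have q0 : 0 < mdist (q i) x by rewrite mdist_gt0.
  exists (eps * mdist (q i) x / 2); first by rewrite divr_gt0// mulr_gt0.
  move=> r' /andP[_ rr] y xy.
  have t1 := metric_triangle (q i) y x; have t2 := metric_triangle (p i) y x.
  rewrite (metric_sym y x) in t1 t2.
  have : eps * mdist (q i) x <= 1 * mdist (q i) x by rewrite ler_wpM2r// ltW.
  move=> eq1.
  have w1 : eps * (mdist (q i) x / 2) <= eps * mdist (q i) y.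
    by rewrite ler_pM2l//; lra.
  have w2 : eps * (mdist (q i) x / 2) <= eps * mdist (p i) y.
    by rewrite ler_pM2l//; lra.
  by split; lra.
pose r := Num.min r1 (Num.min r2 r3).
have r0 : 0 < r by rewrite !lt_min r10 r20.
have rr2 : 0 < r <= r2 by rewrite r0 !ge_min lexx/= ?orbT.
have rr3 : 0 < r <= r3 by rewrite r0 !ge_min lexx/= ?orbT.
have rr1 : r <= r1 by rewrite ge_min lexx.
have nst y : mdist x y < r -> strainer_cos S kap sig k y p q.
  by move=> xy; apply: near1; exact: lt_le_trans rr1.
have nsum i y z : (i < k)%N -> mdist x y < r -> mdist x z < r ->
    mdist (p i) z + mdist (q i) z - (mdist (p i) y + mdist (q i) y)
    <= (12 + 3 * S) * th * mdist y z.
  by move=> ik; exact: near2 ik _ rr2 y z.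
exists r; split=> //; split.
- by move=> i y ik xy; exact: near3 ik _ rr3 y xy.
- move=> i y z ik xy xz; apply: le_trans (nsum i y z ik xy xz) _.
  by rewrite ler_wpM2r ?mdist_ge0//; lra.
move=> i y s ik s0 xys.
have xy : mdist x y < r by lra.
have [g1 g2 g3] := nst y xy.
have [py qy qp er an] := g1 i ik.
have [far1 far2] := near3 i ik r rr3 y xy.
have p0 : 0 < mdist (p i) y by rewrite mdist_gt0.
have q0 : 0 < mdist (q i) y by rewrite mdist_gt0.
have sb b : b != y -> r <= eps * mdist b y ->
    0 <= s / mdist y b <= 1 /\ s / mdist y b * mdist y b = s.
  move=> bY far; have b0 : 0 < mdist b y by rewrite mdist_gt0.
  rewrite (metric_sym y b) divr_ge0 ?(ltW b0)//= ler_pdivrMr// mul1r; split.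
    have : eps * mdist b y <= 1 * mdist b y by rewrite ler_pM2r.
    have := mdist_ge0 x y; lra.
  by field; rewrite gt_eqF.
have cross b : b != y -> r <= eps * mdist b y -> mdist b y <= mdist (p i) y ->
    (forall j, (j < i)%N -> cosang (p j) y b < sig /\ cosang (q j) y b < sig) ->
    forall j, (j < i)%N ->
    `|mdist (p j) (gd y b (s / mdist y b)) - mdist (p j) y| <= eps * s.
  move=> bY far bp angs j ji; have [t01 tE] := sb b bY far.
  have jk := ltn_trans ji ik; have [pj qj qpj _ _] := g1 j jk.
  have [a1 a2] := angs j ji.
  have [n1 n2] := strainer_nested (nst y xy) S_ge1 (ltW kap0) (introT andP (conj ji ik)).
  have nb : (S - 1) * mdist b y <= (S - 1) * mdist (p i) y.
    by rewrite ler_wpM2l//; lra.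
  have zx : mdist x (gd y b (s / mdist y b)) < r.
    have := metric_triangle x y (gd y b (s / mdist y b)).
    by rewrite (mdist_geol X_geodesic)// tE; lra.
  have hs := nsum j y _ jk xy zx.
  rewrite (mdist_geol X_geodesic)// in hs.
  have cc : 0 <= (12 + 3 * S) * th by rewrite mulr_ge0// ?(ltW th0)//; lra.
  have nq : kap * (2 * mdist (q j) y) <= kap * (2 * mdist (p j) y).
    by rewrite !ler_pM2l// ltW.
  have sg0 : 0 <= sig by rewrite divr_ge0// ltW.
  have sgE : sig = eps / 4 by [].
  have := @cross_slope kap sig (s / mdist y b) (p j) (q j) y b ((12 + 3 * S) * th)
    t01 pj qj bY.
  rewrite !tE in hs * => h; apply: le_trans (h _ _ _ _ _ hs _ cc) _ => //; try lra.
  by rewrite ler_wpM2r//; lra.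
have [tq tqE] := sb _ qy far2; have [tp tpE] := sb _ py far1.
split.
  exists (gd y (q i) (s / mdist y (q i))); split.
  - by rewrite (mdist_geol X_geodesic)// tqE.
  - have th2 : 0 < th ^+ 2 <= 2^-1 by rewrite exprn_gt0//= expr2; nra.
    have st2 : strainer1_cos S ((th ^+ 2) ^+ 2) y (p i) (q i).
      by rewrite -exprM; exact: g1.
    have := slope_toward_opposite S_ge1 X_geodesic X_concave th2 st2 tq.
    rewrite tqE -exprM; apply: le_trans; rewrite lerD2l ler_wpM2r//.
    by move: kape; rewrite /kap; lra.
  - apply: cross => //; first exact: ltW.
    by move=> j ji; have [] := g3 j i (introT andP (conj ji ik)).
exists (gd y (p i) (s / mdist y (p i))); split.
- by rewrite (mdist_geol X_geodesic)// tpE.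
- rewrite metric_sym (mdist_geor X_geodesic)// mulrBl mul1r tpE.
  by rewrite (metric_sym y (p i)).
- apply: cross => //.
  by move=> j ji; have [] := g3 j i (introT andP (conj ji ik)).
Qed.

End Frames.

(** * Distance maps from a strainer are open *)

Section GeometricSequences.
Context {R : realType} {X : metricType R}.
Hypothesis X_complete : complete_space X.

Lemma le0_geometric (a B lam : R) : 0 <= lam < 1 ->
  (forall m, a <= B * lam ^+ m) -> a <= 0.
Proof.
move=> /andP[l0 l1] h.
have cv : B * lam ^+ m @[m --> \oo] --> B * 0.
  by apply: cvgM; [exact: cvg_cst|apply: cvg_expr; rewrite ger0_norm].
rewrite mulr0 in cv; rewrite -(cvg_lim (@Rhausdorff R) cv).
by apply: limr_ge; [exact: cvgP cv|apply: nearW => m; exact: h].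
Qed.

Lemma geometric_cvg (u : nat -> X) (C lam : R) : 0 <= C -> 0 <= lam < 1 ->
  (forall m, mdist (u m) (u m.+1) <= C * lam ^+ m) ->
  exists l, forall m, mdist (u m) l <= C * lam ^+ m / (1 - lam).
Proof.
move=> C0 /andP[l0 l1] h; have l1' : 0 < 1 - lam by lra.
have hj m j : mdist (u m) (u (m + j)%N) <= C * lam ^+ m / (1 - lam) * (1 - lam ^+ j).
  elim: j => [|j IH]; first by rewrite addn0 mdistxx expr0 subrr mulr0.
  rewrite addnS; apply: le_trans (metric_triangle _ (u (m + j)%N) _) _.
  apply: le_trans (lerD IH (h _)) _.
  by rewrite exprD exprS le_eqVlt; apply/orP; left; apply/eqP; field; lra.
have hm m j : (m <= j)%N -> mdist (u m) (u j) <= C * lam ^+ m / (1 - lam).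
  move=> mj; rewrite -(subnKC mj); apply: le_trans (hj _ _) _.
  rewrite ler_piMr//; last by have : 0 <= lam ^+ (j - m) by [rewrite exprn_ge0|]; lra.
  by rewrite divr_ge0 ?(ltW l1')// mulr_ge0// exprn_ge0.
have cvu : C * lam ^+ m / (1 - lam) @[m --> \oo] --> (0 : R).
  rewrite -[X in _ --> X](mul0r (1 - lam)^-1) -(mulr0 C).
  apply: cvgM; last exact: cvg_cst.
  by apply: cvgM; [exact: cvg_cst|apply: cvg_expr; rewrite ger0_norm].
have [l ul] : exists l : X, u m @[m --> \oo] --> l.
  suff cu : cauchy (u m @[m --> \oo]) by exact: X_complete cu.
  apply: cauchy_exP => e e0.
  have [N _ hN] : \forall m \near \oo, C * lam ^+ m / (1 - lam) < e.
    exact: cvgr_lt cvu _ e0.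
  exists (u N); exists N => // m /= Nm; rewrite ballEmdist/=.
  by apply: le_lt_trans (hm _ _ Nm) _; exact: hN (leqnn _).
exists l => m.
have cd : mdist (u m) (u j) @[j --> \oo] --> mdist (u m) l.
  exact: (cvg_comp _ _ ul (@cvg_mdist _ _ (u m) l)).
rewrite -(cvg_lim (@Rhausdorff R) cd).
apply: limr_le; first exact: cvgP cd.
by exists m => // j /= mj; exact: hm.
Qed.

End GeometricSequences.

Lemma dist_mdist_le {R : realType} {X : metricType R} (a y z : X) :
  `|mdist a z - mdist a y| <= mdist y z.
Proof.
have t1 := metric_triangle a y z; have t2 := metric_triangle a z y.
rewrite (metric_sym z y) in t2.
by rewrite ler_norml; apply/andP; split; lra.
Qed.

Section OpenFrames.
Context {R : realType} {X : metricType R}.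
Hypothesis X_complete : complete_space X.
Implicit Types (x y z : X) (p q : nat -> X) (v : nat -> R).

(** The weights decrease so fast that correcting one coordinate, which may
    spoil all later ones, still decreases the weighted error. *)
Let weight k (i : nat) : R := (6 * k%:R) ^- i.

Let werror k p v y : R := \sum_(i < k) weight k i * `|v i - mdist (p i) y|.

Let weight_gt0 k i : 0 < weight k.+1 i.
Proof. by rewrite invr_gt0 exprn_gt0// mulr_gt0. Qed.

Let base_ge1 k : 1 <= 6 * k.+1%:R :> R.
Proof. have : (1 : R) <= k.+1%:R by rewrite ler1n. lra. Qed.

Let weight_le k i j : (i <= j)%N -> weight k.+1 j <= weight k.+1 i.
Proof.
move=> ij; rewrite lef_pV2 ?posrE ?exprn_gt0 ?mulr_gt0//.
by rewrite ler_weXn2l.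
Qed.

Let weight_lt k i j : (i < j)%N -> weight k.+1 j <= weight k.+1 i / (6 * k.+1%:R).
Proof.
move=> ij; apply: le_trans (weight_le k ij) _.
by rewrite /weight exprS invfM mulrC.
Qed.

Let werror_ge0 k p v y : 0 <= werror k.+1 p v y.
Proof. by apply: sumr_ge0 => i _; rewrite mulr_ge0// ltW. Qed.

(** Moving toward one point of the [i]-th pair by the [i]-th error nearly
    cancels this error, spoils the earlier coordinates only by a factor [eps],
    and may spoil the later ones fully, which their small weights allow. *)
Lemma framed_step k (eps r : R) x p q v y : 0 < eps ->
  eps <= weight k.+1 k.+1 ->
  framed eps r k.+1 x p q ->
  let C := 3 / 2 / weight k.+1 k.+1 in
  mdist x y + C * werror k.+1 p v y < r ->
  exists z, mdist y z <= C * (werror k.+1 p v y - werror k.+1 p v z) /\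
    werror k.+1 p v z <= (1 - 2 / (3 * k.+1%:R)) * werror k.+1 p v y.
Proof.
move=> eps0 epsw [_ _ fr] C hr; set W := werror k.+1 p v y in hr *.
have K0 : 0 < k.+1%:R :> R by rewrite ltr0n.
have wk0 := weight_gt0 k k.+1.
(* some coordinate carries at least the average weighted error *)
have [i hi] : exists i : 'I_k.+1, W <= k.+1%:R * (weight k.+1 i * `|v i - mdist (p i) y|).
  apply: contrapT => no; have h (i : 'I_k.+1) :
      weight k.+1 i * `|v i - mdist (p i) y| < W / k.+1%:R.
    rewrite ltNge; apply/negP => hle; apply: no; exists i.
    by rewrite mulrC -ler_pdivrMr.
  have : W < \sum_(i < k.+1) W / k.+1%:R.
    apply: ltr_sum => [|i _]; last exact: h.
    by apply/hasP; exists ord0 => //; rewrite mem_index_enum.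
  by rewrite sumr_const card_ord -(mulr_natr (W / _)) divfK ?gt_eqF// ltxx.
set s := `|v i - mdist (p i) y| in hi.
have s0 : 0 <= s by exact: normr_ge0.
have wi0 := weight_gt0 k i.
have wki : weight k.+1 k.+1 <= weight k.+1 i by apply: weight_le; exact: ltnW.
have sW : weight k.+1 i * s <= W.
  rewrite /W /werror (bigD1 i)//= lerDl; apply: sumr_ge0 => j _.
  by rewrite mulr_ge0// ltW.
have sC : s <= C * W.
  have : weight k.+1 k.+1 * s <= W.
    by apply: le_trans sW; rewrite ler_wpM2r.
  rewrite mulrC -ler_pdivlMr// => h; apply: le_trans h _.
  have : 0 <= W / weight k.+1 k.+1 by rewrite divr_ge0 ?(ltW wk0)//; exact: werror_ge0.
  rewrite /C; set t := W / _; have -> : 3 / 2 / weight k.+1 k.+1 * W = 3 / 2 * t.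
    by rewrite /t; ring.
  lra.
have w6 : weight k.+1 k.+1 <= weight k.+1 i / (6 * k.+1%:R) by exact: weight_lt.
have w1 j : weight k.+1 j <= 1 by rewrite -[leRHS]invr1 -[X in X^-1](expr0 (6 * k.+1%:R)); exact: weight_le.
have wK : weight k.+1 i / (6 * k.+1%:R) <= 6^-1.
  rewrite ler_pdivrMr ?mulr_gt0// mulrA mulVf// mul1r.
  by apply: le_trans (w1 i) _; rewrite ler1n.
have [[z1 [dz1 up1 cr1]] [z2 [dz2 up2 cr2]]] := fr i y s (ltn_ord i) s0 (le_lt_trans (lerD (lexx _) sC) hr).
have [z [dz upz crz]] : exists z, [/\ mdist y z = s,
    `|v i - mdist (p i) z| <= 6^-1 * s &
    forall j, (j < i)%N -> `|mdist (p j) z - mdist (p j) y| <= eps * s].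
  have e6 : eps <= 6^-1 by apply: le_trans epsw _; exact: le_trans w6 wK.
  have es : eps * s <= 6^-1 * s by rewrite ler_wpM2r.
  have [vle|vlt] := leP (v i) (mdist (p i) y).
    have sE : s = mdist (p i) y - v i by rewrite /s ler0_norm ?opprB// subr_le0.
    exists z2; split=> //; rewrite up2 {1}sE (_ : v i - _ = 0); last by ring.
    by rewrite normr0 mulr_ge0// invr_ge0.
  exists z1; split=> //.
  have sE : s = v i - mdist (p i) y by rewrite /s gtr0_norm// subr_gt0.
  have := dist_mdist_le (p i) y z1; rewrite dz1 !ler_norml => /andP[u1 u2].
  by apply/andP; split; lra.
have key : werror k.+1 p v z <= W - 2 / 3 * (weight k.+1 i * s).
  rewrite /W /werror (bigD1 i)//= [in leRHS](bigD1 i)//=.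
  have a1 : weight k.+1 i * `|v i - mdist (p i) z| <= weight k.+1 i * (6^-1 * s).
    by rewrite ler_pM2l.
  have a2 : \sum_(j < k.+1 | j != i) weight k.+1 j * `|v j - mdist (p j) z| <=
     \sum_(j < k.+1 | j != i) (weight k.+1 j * `|v j - mdist (p j) y|) +
     \sum_(j < k.+1 | j != i) (weight k.+1 i / (6 * k.+1%:R) * s).
    rewrite -big_split/=; apply: ler_sum => j ji.
    have n1 : `|v j - mdist (p j) z| <= `|v j - mdist (p j) y| + `|mdist (p j) z - mdist (p j) y|.
      rewrite -(normrN (mdist (p j) z - _)); apply: le_trans _ (ler_normD _ _).
      by rewrite le_eqVlt; apply/orP; left; apply/eqP; congr `|_|; ring.
    have wj0 := weight_gt0 k j.
    apply: le_trans (ler_wpM2l (ltW wj0) n1) _; rewrite mulrDr lerD2l.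
    have : (j < i)%N || (i < j)%N by rewrite -neq_ltn.
    move=> /orP[ltji|ltij].
      apply: le_trans (ler_wpM2l (ltW wj0) (crz j ltji)) _.
      rewrite mulrA ler_wpM2r//; apply: le_trans w6; apply: le_trans epsw.
      by rewrite ler_piMl// ltW.
    apply: le_trans (ler_wpM2l (ltW wj0) (dist_mdist_le (p j) y z)) _.
    by rewrite dz ler_wpM2r//; exact: weight_lt.
  have a3 : \sum_(j < k.+1 | j != i) (weight k.+1 i / (6 * k.+1%:R) * s) <= 6^-1 * (weight k.+1 i * s).
    apply: (@le_trans _ _ (\sum_(j < k.+1) (weight k.+1 i / (6 * k.+1%:R) * s))).
      by rewrite [leRHS](bigD1 i)//= lerDr mulr_ge0// divr_ge0// ?mulr_ge0// ltW.
    rewrite sumr_const card_ord -(mulr_natr (_ * s)) le_eqVlt; apply/orP; left; apply/eqP.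
    by field; rewrite gt_eqF.
  rewrite -/s; lra.
exists z; split.
  have h : 2 / 3 * (weight k.+1 k.+1 * s) <= W - werror k.+1 p v z.
    have : weight k.+1 k.+1 * s <= weight k.+1 i * s by rewrite ler_wpM2r.
    lra.
  rewrite dz /C mulrAC ler_pdivlMr//; lra.
apply: le_trans key _.
have : W / k.+1%:R <= weight k.+1 i * s by rewrite ler_pdivrMr// mulrC.
have -> : (1 - 2 / (3 * k.+1%:R)) * W = W - 2 / 3 * (W / k.+1%:R).
  by field; rewrite gt_eqF.
by move: (W / _) (weight _ _ * s) => a b; lra.
Qed.

(** Iterating [framed_step], the error decreases geometrically and bounds the
    length of the steps, so the points converge to an exact solution. *)
Lemma framed_open k : exists eps0 C : R, [/\ 0 < eps0 <= 1, 0 < C &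
  forall (eps r : R) x p q, 0 < eps <= eps0 -> framed eps r k x p q ->
  forall y v, mdist x y + C * \sum_(i < k) `|v i - mdist (p i) y| < r ->
  exists z, mdist y z <= C * \sum_(i < k) `|v i - mdist (p i) y| /\
    forall i, (i < k)%N -> mdist (p i) z = v i].
Proof.
case: k => [|k].
  exists 1, 1; split=> // [|eps r x p q _ _ y v _]; first by rewrite ltr01 lexx.
  by exists y; rewrite big_ord0 mulr0 mdistxx.
have wk0 := weight_gt0 k k.+1.
have w1 j : weight k.+1 j <= 1 by rewrite -[leRHS]invr1 -[X in X^-1](expr0 (6 * k.+1%:R)); exact: weight_le.
pose C := 3 / 2 / weight k.+1 k.+1.
have C0 : 0 < C by rewrite divr_gt0.
exists (weight k.+1 k.+1), C; split; [by rewrite wk0 w1|by []|].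
move=> eps r x p q /andP[eps0 epsw] fr y v hr.
have K0 : 0 < k.+1%:R :> R by rewrite ltr0n.
have WS : werror k.+1 p v y <= \sum_(i < k.+1) `|v i - mdist (p i) y|.
  by apply: ler_sum => i _; rewrite ler_piMl.
have step w : exists z, mdist x w + C * werror k.+1 p v w < r ->
    mdist w z <= C * (werror k.+1 p v w - werror k.+1 p v z) /\
    werror k.+1 p v z <= (1 - 2 / (3 * k.+1%:R)) * werror k.+1 p v w.
  have [hw|hw] := ltP (mdist x w + C * werror k.+1 p v w) r; last by exists w.
  by have [z hz] := framed_step eps0 epsw fr hw; exists z.
have [F hF] := choice step.
pose lam : R := 1 - 2 / (3 * k.+1%:R).
have lam01 : 0 <= lam < 1.
  have : (0 : R) < (2 / (3 * k.+1%:R) : R) <= (1 : R).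
    rewrite divr_gt0 ?mulr_gt0//= ler_pdivrMr ?mulr_gt0// mul1r.
    have : (1 : R) <= k.+1%:R by rewrite ler1n.
    lra.
  by rewrite /lam; set e := 2 / _ => /andP[? ?]; apply/andP; split; lra.
pose u m := iter m F y.
have inv m : [/\ mdist x (u m) + C * werror k.+1 p v (u m) < r,
    mdist y (u m) <= C * (werror k.+1 p v y - werror k.+1 p v (u m)) &
    werror k.+1 p v (u m) <= lam ^+ m * werror k.+1 p v y].
  elim: m => [|m [i1 i2 i3]].
    split; last by rewrite expr0 mul1r.
      by apply: le_lt_trans hr; rewrite lerD2l ler_pM2l.
    by rewrite subrr mulr0 mdistxx.
  have [j1 j2] := hF (u m) i1; rewrite -[F _]/(u m.+1) in j1 j2.
  have t1 := metric_triangle x (u m) (u m.+1); have t2 := metric_triangle y (u m) (u m.+1).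
  split; [lra|lra|].
  rewrite exprS -mulrA; apply: le_trans j2 _; rewrite ler_wpM2l//.
  by case/andP: lam01.
have Wy0 := werror_ge0 k p v y.
have dstep m : mdist (u m) (u m.+1) <= C * werror k.+1 p v y * lam ^+ m.
  have [i1 _ i3] := inv m; have [j1 _] := hF (u m) i1; apply: le_trans j1 _.
  rewrite -mulrA ler_pM2l//; have := werror_ge0 k p v (F (u m)).
  by rewrite (mulrC (werror _ _ _ y)); lra.
have CW : 0 <= C * werror k.+1 p v y by rewrite mulr_ge0// ltW.
have [z hz] := geometric_cvg X_complete CW lam01 dstep.
exists z; split.
  rewrite -subr_le0; apply: (le0_geometric (B := C * werror k.+1 p v y / (1 - lam)) lam01) => m.
  have [_ i2 _] := inv m; have := hz m; have := metric_triangle y (u m) z.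
  have w0 := werror_ge0 k p v (u m).
  have : C * werror k.+1 p v y <= C * \sum_(i < k.+1) `|v i - mdist (p i) y|.
    by rewrite ler_pM2l.
  have : 0 <= C * werror k.+1 p v (u m) by rewrite mulr_ge0// ltW.
  rewrite (mulrAC _ _ (lam ^+ m)); lra.
move=> i ik; apply/eqP; rewrite eq_sym -subr_eq0 -normr_le0.
pose B := C * werror k.+1 p v y / (1 - lam) + werror k.+1 p v y / weight k.+1 i.
apply: (le0_geometric (B := B) lam01) => m.
have [_ _ i3] := inv m; have hzm := hz m.
have n1 : `|v i - mdist (p i) z| <= `|v i - mdist (p i) (u m)| + `|mdist (p i) z - mdist (p i) (u m)|.
  rewrite -(normrN (mdist (p i) z - _)); apply: le_trans _ (ler_normD _ _).
  by rewrite le_eqVlt; apply/orP; left; apply/eqP; congr `|_|; ring.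
have n2 := dist_mdist_le (p i) (u m) z.
have wi0 := weight_gt0 k i.
have n3 : `|v i - mdist (p i) (u m)| <= werror k.+1 p v y / weight k.+1 i * lam ^+ m.
  rewrite mulrAC ler_pdivlMr// mulrC (mulrC _ (lam ^+ m)); apply: le_trans i3.
  rewrite /werror (bigD1 (Ordinal ik))//= lerDl; apply: sumr_ge0 => j _.
  by rewrite mulr_ge0// ltW.
rewrite /B mulrDl (mulrAC _ _ (lam ^+ m)); lra.
Qed.

End OpenFrames.

(** * Sets of vanishing Hausdorff measure *)

(** Bounds [r i] of the diameters are used instead of the diameters, so that
    all computations take place in [R]. No bound is put on the [r i]: small
    sums force them to be small. *)
Definition hausdorff_null {R : realType} {X : metricType R} (s : R) (A : set X) :=
  forall e : R, 0 < e -> exists (U : nat -> set X) (r : nat -> R),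
    [/\ A `<=` \bigcup_i U i, forall i, 0 <= r i,
        forall i x y, U i x -> U i y -> mdist x y <= r i
      & (\sum_(0 <= i <oo) (r i `^ s)%:E <= e%:E)%E].

Section HausdorffNull.
Context {R : realType} {X : metricType R}.
Implicit Types (A B U : set X) (s e : R) (x y : X).

Lemma diam_ge0 A : (0 <= diam A)%E.
Proof. by apply: ereal_sup_ubound; left. Qed.

Lemma mdist_le_diam A x y : A x -> A y -> ((mdist x y)%:E <= diam A)%E.
Proof. by move=> Ax Ay; apply: ereal_sup_ubound; right; exists (x, y). Qed.

Lemma diam_le A (r : R) : 0 <= r -> (forall x y, A x -> A y -> mdist x y <= r) ->
  (diam A <= r%:E)%E.
Proof.
move=> r0 h; apply: ge_ereal_sup => _ [->|[[x y] [Ax Ay] <-]].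
  by rewrite lee_fin.
by rewrite lee_fin; exact: h.
Qed.

Lemma nneseries_term_le (u : nat -> R) e i : (forall j, 0 <= u j) ->
  (\sum_(0 <= j <oo) (u j)%:E <= e%:E)%E -> u i <= e.
Proof.
move=> u0 h; rewrite -lee_fin; apply: le_trans h.
have h := @nneseries_lim_ge _ (fun j => (u j)%:E) xpredT 0%N i.+1.
apply: le_trans (h _); last by move=> j _ _; rewrite lee_fin.
rewrite big_nat_recr//= leeDr// sume_ge0// => j _; by rewrite lee_fin.
Qed.

Lemma hausdorff_measure_null s A : 0 < s ->
  hausdorff_measure s A = 0%E -> hausdorff_null s A.
Proof.
move=> s0 h0 e e0.
have : (hausdorff_premeasure s 1 A < e%:E)%E.
  apply: (@le_lt_trans _ _ 0%E); last by rewrite lte_fin.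
  by rewrite -h0; apply: ereal_sup_ubound; exists 1 => //=; exact: ltr01.
move=> /ereal_inf_lt[_ [U [AU Ud] <-] Ue].
have Ufin i : diam (U i) \is a fin_num.
  by rewrite ge0_fin_numE ?diam_ge0// (le_lt_trans (Ud i)) ?ltry.
exists U, (fun i => fine (diam (U i))); split=> //.
- by move=> i; rewrite fine_ge0 ?diam_ge0.
- by move=> i x y Ux Uy; rewrite -lee_fin fineK//; exact: mdist_le_diam.
- apply: le_trans (ltW Ue); rewrite le_eqVlt; apply/orP; left; apply/eqP.
  by apply: eq_eseriesr => i _; rewrite -poweR_EFin fineK.
Qed.

Lemma hausdorff_null_measure s A : 0 < s ->
  hausdorff_null s A -> hausdorff_measure s A = 0%E.
Proof.
move=> s0 h; apply/eqP; rewrite eq_le; apply/andP; split; last first.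
  apply: le_ereal_sup_tmp; exists (hausdorff_premeasure s 1 A); first by exists 1 => //=; exact: ltr01.
  apply: le_ereal_inf_tmp => _ [U _ <-].
  by apply: nneseries_ge0 => i _ _; exact: poweR_ge0.
apply: ge_ereal_sup => _ [eps /= eps0 <-].
apply/lee_addgt0Pr => e e0; rewrite add0e.
pose e' := Num.min e (eps `^ s).
have e'0 : 0 < e' by rewrite lt_min e0 powR_gt0.
have [U [r [AU r0 Ur Us]]] := h e' e'0.
apply: ge_ereal_inf; exists (\sum_(0 <= i <oo) (diam (U i) `^ s))%E.
  exists U => //; split=> // i; apply: le_trans (diam_le (r0 i) (Ur i)) _.
  rewrite lee_fin leNgt; apply/negP => epsr.
  have := nneseries_term_le i (fun j => powR_ge0 (r j) s) Us.
  rewrite leNgt => /negP; apply; rewrite (@le_lt_trans _ _ (eps `^ s))//.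
    by rewrite ge_min lexx orbT.
  by rewrite gt0_ltr_powR// nnegrE// ltW.
apply: (@le_trans _ _ e'%:E); last by rewrite lee_fin ge_min lexx.
apply: le_trans Us; apply: lee_nneseries => i _; first by rewrite poweR_ge0.
rewrite -poweR_EFin; apply: gt0_ler_poweR; rewrite ?(ltW s0)//.
- by rewrite in_itv/= diam_ge0 leey.
- by rewrite in_itv/= lee_fin r0 leey.
- exact: diam_le (r0 i) (Ur i).
Qed.

Lemma hausdorff_null_mono s s' A : 0 < s -> s <= s' ->
  hausdorff_null s A -> hausdorff_null s' A.
Proof.
move=> s0 ss' h e e0.
have e'0 : 0 < Num.min e 1 by rewrite lt_min e0 ltr01.
have [U [r [AU r0 Ur Us]]] := h _ e'0.
exists U, r; split=> //.
apply: (@le_trans _ _ (Num.min e 1)%:E); last by rewrite lee_fin ge_min lexx.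
apply: (le_trans _ Us); apply: lee_nneseries => i _; first by rewrite lee_fin powR_ge0.
rewrite lee_fin.
have ri1 : r i <= 1.
  rewrite leNgt; apply/negP => r1.
  have := nneseries_term_le i (fun j => powR_ge0 (r j) s) Us.
  rewrite leNgt => /negP; apply; apply: (@le_lt_trans _ _ 1).
    by rewrite ge_min lexx orbT.
  have one : 1 `^ s = 1 :> R by rewrite powR1.
  by rewrite -one gt0_ltr_powR// nnegrE.
have [r0'|rn] := eqVneq (r i) 0.
  by rewrite r0' !powR0// gt_eqF//; exact: lt_le_trans ss'.
by apply: ger_powR => //; rewrite lt_neqAle eq_sym rn r0.
Qed.

Lemma hausdorff_null_subset s A B : A `<=` B -> hausdorff_null s B -> hausdorff_null s A.
Proof.
move=> AB h e e0; have [U [r [BU r0 Ur Us]]] := h e e0.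
by exists U, r; split=> //; exact: subset_trans AB BU.
Qed.

Lemma hausdorff_null_bigcup s (A : nat -> set X) :
  (forall n, hausdorff_null s (A n)) -> hausdorff_null s (\bigcup_n A n).
Proof.
move=> h e e0.
have en0 n : 0 < e / (2 ^ n.+1)%:R by rewrite divr_gt0// ltr0n expn_gt0.
have [U hU] := choice (fun n => h n _ (en0 n)).
have [r hr] := choice hU.
have /card_esym/ppcard_eqP[f] := card_nat2.
exists (fun k => U (f k).1 (f k).2), (fun k => r (f k).1 (f k).2); split.
- move=> x [n _ Anx]; have [AU _ _ _] := hr n; have [m _ Ux] := AU x Anx.
  by exists (f^-1%FUN (n, m)) => //=; rewrite invK ?inE.
- by move=> k; have [_ r0 _ _] := hr (f k).1.
- by move=> k x y; have [_ _ Ur _] := hr (f k).1; exact: Ur.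
- pose a n m : \bar R := (r n m `^ s)%:E.
  have a0 n m : (0 <= a n m)%E by rewrite lee_fin powR_ge0.
  rewrite -[X in (X <= _)%E]/(\sum_(0 <= k <oo) a (f k).1 (f k).2)%E.
  rewrite nneseries_esumT//.
  rewrite -(@reindex_esum _ _ _ setT setT f (fun k => a k.1 k.2)); last exact: 'bij_f.
  have -> : [set: nat * nat] = [set: nat] `*`` (fun=> [set: nat]).
    by apply/seteqP; split => -[].
  rewrite -esum_esum//.
  under eq_esum do rewrite -nneseries_esumT//.
  rewrite -nneseries_esumT; last by move=> n; apply: nneseries_ge0 => m _ _.
  apply: le_trans (epsilon_trick0 xpredT (ltW e0)).
  apply: lee_nneseries => n _; first by move=> _; apply: nneseries_ge0 => m _ _.
  by have [_ _ _] := hr n.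
Qed.

Lemma hausdorff_null0 s : 0 < s -> hausdorff_null s (set0 : set X).
Proof.
move=> s0 e e0; exists (fun=> set0), (fun=> 0); split=> //.
by rewrite powR0 ?gt_eqF// eseries0// lee_fin ltW.
Qed.

Lemma hausdorff_nullU s A B : hausdorff_null s A -> hausdorff_null s B ->
  hausdorff_null s (A `|` B).
Proof.
move=> hA hB.
apply: (@hausdorff_null_subset _ _ (\bigcup_n (if n is 0%N then A else B))).
  by move=> x [Ax|Bx]; [exists 0%N|exists 1%N].
by apply: hausdorff_null_bigcup => -[|n].
Qed.

(** The finite cover is completed by empty sets, which contribute nothing
    because [s] is positive. *)
Lemma hausdorff_null_finite s A : 0 < s ->
  (forall e, 0 < e -> exists (I : finType) (U : I -> set X) (rho : R),
    [/\ A `<=` \bigcup_i U i, 0 <= rho,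
        forall i x y, U i x -> U i y -> mdist x y <= rho
      & #|I|%:R * rho `^ s <= e]) -> hausdorff_null s A.
Proof.
move=> s0 h e e0; have [I [U [rho [AU rho0 Ur Ue]]]] := h e e0.
pose V k : set X := if @insub _ (fun k => k < #|I|)%N 'I_#|I| k is Some i then U (enum_val i) else set0.
exists V, (fun k => if (k < #|I|)%N then rho else 0); split.
- move=> x /AU[i _ Uix]; exists (enum_rank i) => //.
  by rewrite /V valK enum_rankK.
- by move=> k; case: ifP.
- by move=> k x y; rewrite /V; case: insubP => [i ik _|//]; rewrite ik; exact: Ur.
- apply: (@le_trans _ _ (#|I|%:R * rho `^ s)%:E); last by rewrite lee_fin.
  rewrite (nneseries_split 0 #|I|); last first.
    by move=> k _; rewrite lee_fin powR_ge0.
  rewrite add0n [X in (_ + X)%E]eseries0; last first.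
    by move=> k Ik _; rewrite ltnNge Ik/= powR0 ?gt_eqF.
  rewrite adde0 sumEFin lee_fin.
  rewrite (@eq_big_nat _ _ _ _ _ _ (fun=> rho `^ s)); last first.
    by move=> k /andP[_ ->].
  by rewrite sumr_const_nat subn0 mulr_natl.
Qed.

Lemma hausdorff_dim_le A (d : R) : 0 <= d ->
  (forall s, d < s -> hausdorff_null s A) -> (hausdorff_dim A <= d%:E)%E.
Proof.
move=> d0 h; apply/lee_addgt0Pr => e e0; rewrite -EFinD.
apply: ereal_inf_lbound; exists (d + e) => //; split; first exact: ltr_wpDl.
by apply: hausdorff_null_measure; [exact: ltr_wpDl|apply: h; rewrite ltrDl].
Qed.

Lemma hausdorff_dim_null A (d s : R) : hausdorff_dim A = d%:E -> d < s ->
  hausdorff_null s A.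
Proof.
move=> dE ds; have : (hausdorff_dim A < s%:E)%E by rewrite dE lte_fin.
move=> /ereal_inf_lt[_ [s' [s'0 hs'] <-]]; rewrite lte_fin => s's.
apply: (hausdorff_null_mono s'0 (ltW s's)).
exact: hausdorff_measure_null.
Qed.

(** A Hoelder inverse carries Lebesgue measure on the unit interval over to
    the Hausdorff measure. *)
Lemma hausdorff_null_interval (f : R -> X) (C s : R) : 0 < C ->
  (forall u v : R, 0 <= u <= 1 -> 0 <= v <= 1 -> `|u - v| <= C * mdist (f u) (f v) `^ s) ->
  0 < s -> ~ hausdorff_null s [set: X].
Proof.
move=> C0 hf s0 h.
have e0 : 0 < (4 * C)^-1 by rewrite invr_gt0 mulr_gt0.
have [U [r [AU r0 Ur Us]]] := h _ e0.
have hex i : exists c : R,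
    `[0, 1]%classic `&` f @^-1` U i `<=` `[c - C * r i `^ s, c + C * r i `^ s]%classic.
  have [[u [u01 Uu]]|no] := pselect (exists u, `[0, 1]%classic u /\ U i (f u)); last first.
    by exists 0 => u [u01 Uu]; exfalso; apply: no; exists u.
  exists u => v [v01 Uv]; move: u01 v01; rewrite /= !in_itv/= => u01 v01.
  have := hf u v u01 v01.
  have : C * mdist (f u) (f v) `^ s <= C * r i `^ s.
    rewrite ler_pM2l// ge0_ler_powR ?nnegrE ?mdist_ge0// ?(ltW s0)//.
    exact: Ur Uu Uv.
  move=> h1 h2; have := le_trans h2 h1; rewrite ler_norml => /andP[h3 h4].
  by apply/andP; split; lra.
have [F hF] := choice hex.
have Cr i : 0 <= C * r i `^ s by rewrite mulr_ge0 ?powR_ge0// ltW.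
have := @measure_sigma_subadditive _ _ _ (@lebesgue_measure R) `[0, 1]%classic
  (fun i => `[F i - C * r i `^ s, F i + C * r i `^ s]%classic).
move=> /(_ (fun=> measurable_itv _) (measurable_itv _)) H.
have : (1%:E <= 2^-1%:E :> \bar R)%E.
  have -> : 1%:E = (@lebesgue_measure R) (`[0, 1]%classic : set R).
    by rewrite lebesgue_measure_itv/= lte_fin ltr01 sube0.
  apply: le_trans (H _) _.
    by move=> u u01; have [i _ Ui] := AU (f u) I; exists i => //; exact: hF.
  apply: (@le_trans _ _ ((2 * C)%:E * \sum_(0 <= i <oo) (r i `^ s)%:E)%E).
    rewrite -nneseriesZl; last by move=> i _; rewrite lee_fin powR_ge0.
    apply: lee_nneseries => i _; first by move=> _; exact: measure_ge0.
    suff : ((@lebesgue_measure R) (`[(F i - C * r i `^ s)%R, (F i + C * r i `^ s)%R]%classic : set R)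
        <= (2 * C)%:E * (r i `^ s)%:E)%E by [].
    rewrite lebesgue_measure_itv/=; case: ifP => _; last first.
      by rewrite -EFinM lee_fin mulr_ge0 ?powR_ge0// mulr_ge0// ltW.
    by rewrite -EFinB -EFinM lee_fin; lra.
  apply: le_trans (lee_wpmul2l _ Us) _.
    by rewrite lee_fin mulr_ge0// ltW.
  by rewrite -EFinM lee_fin; have -> : 2 * C / (4 * C) = 2^-1 by field; rewrite gt_eqF.
by rewrite lee_fin; lra.
Qed.

End HausdorffNull.

(** The preimages of a cover of [B] cover [A], with diameters multiplied by at
    most [C]. *)
Lemma hausdorff_null_expand {R : realType} {X Y : metricType R} (f : X -> Y)
    (C s : R) (A : set X) (B : set Y) : 0 < C -> 0 < s ->
  (forall x, A x -> B (f x)) ->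
  (forall x y, A x -> A y -> mdist x y <= C * mdist (f x) (f y)) ->
  hausdorff_null s B -> hausdorff_null s A.
Proof.
move=> C0 s0 AB hf h e e0.
have Cs : 0 < C `^ s by rewrite powR_gt0.
have [U [r [BU r0 Ur Us]]] := h (e / C `^ s) (divr_gt0 e0 Cs).
exists (fun i => A `&` f @^-1` U i), (fun i => C * r i); split.
- by move=> x Ax; have [i _ Ui] := BU _ (AB x Ax); exists i.
- by move=> i; rewrite mulr_ge0// ltW.
- move=> i x y [Ax Ux] [Ay Uy]; apply: le_trans (hf x y Ax Ay) _.
  by rewrite ler_pM2l//; exact: Ur Ux Uy.
- apply: (@le_trans _ _ ((C `^ s)%:E * \sum_(0 <= i <oo) (r i `^ s)%:E)%E).
    rewrite -nneseriesZl; last by move=> i _; rewrite lee_fin powR_ge0.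
    apply: lee_nneseries => i _; first by rewrite lee_fin powR_ge0.
    by rewrite powRM ?(ltW C0).
  apply: le_trans (lee_wpmul2l _ Us) _; first by rewrite lee_fin ltW.
  by rewrite -EFinM lee_fin mulrCA divff ?mulr1// gt_eqF.
Qed.

(** The Lindeloef argument: by separability, countably many balls with centres
    in a dense set and radii [m.+1%:R^-1] suffice. *)
Lemma hausdorff_null_local {R : realType} {X : metricType R} (s : R) (A : set X) :
  separable_space X -> 0 < s ->
  (forall x, A x -> exists2 rho : R, 0 < rho &
     hausdorff_null s (A `&` [set y | mdist x y < rho])) ->
  hausdorff_null s A.
Proof.
move=> [D cD dD] s0 h.
pose good (x : X) (m : nat) := hausdorff_null s (A `&` [set y | mdist x y < m.+1%:R^-1]).
have [D0|/set0P D0] := eqVneq D set0.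
  apply: (hausdorff_null_subset _ (hausdorff_null0 s0)) => x Ax.
  have := dD setT (ex_intro _ x I) openT; by rewrite D0 setI0 => -[].
have [g gD] : exists g : nat -> X, D `<=` range g.
  have [x0 Dx0] := D0.
  have /countable_injP[f fI] := cD.
  pose g n := if pselect (exists2 x, D x & f x = n) is left h' then
    sval (cid2 h') else x0.
  exists g => x Dx; exists (f x) => //; rewrite /g; case: pselect => [h'|no]; last by case: no; exists x.
  by case: cid2 => y /= Dy fy; apply: fI; rewrite ?inE.
pose B n m : set X := if pselect (good (g n) m) then A `&` [set y | mdist (g n) y < m.+1%:R^-1] else set0.
apply: (@hausdorff_null_subset _ _ _ _ (\bigcup_n \bigcup_m B n m)); last first.
  apply: hausdorff_null_bigcup => n; apply: hausdorff_null_bigcup => m.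
  by rewrite /B; case: pselect => [hg|no]; [exact: hg|exact: hausdorff_null0].
move=> x Ax; have [rho rho0 hrho] := h x Ax.
have [m hm] : exists m : nat, m.+1%:R^-1 < rho / 2.
  exists (Num.truncn (rho / 2)^-1); rewrite -[ltRHS]invrK ltf_pV2 ?posrE ?invr_gt0 ?divr_gt0//.
  by apply: truncnS_gt.
have m0 : 0 < m.+1%:R^-1 :> R by rewrite invr_gt0 ltr0n.
have [y [xy Dy]] : [set y | mdist x y < m.+1%:R^-1] `&` D !=set0.
  rewrite (_ : [set y | _] = ball x m.+1%:R^-1); last by rewrite ballEmdist.
  have := dD (interior (ball x m.+1%:R^-1)) _ (open_interior _).
  case; first by exists x; exact: nbhsx_ballx.
  by move=> y [/interior_subset hy Dy]; exists y.
have [n _ gn] := gD y Dy.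
exists n => //; exists m => //; rewrite /B gn; case: pselect => [gy|no].
  by split=> //=; rewrite metric_sym.
case: no; apply: hausdorff_null_subset hrho => z [Az /= yz]; split=> //=.
apply: le_lt_trans (metric_triangle x y z) _.
by move: (m.+1%:R^-1) hm xy yz => c hm /= xy yz; lra.
Qed.

(** * Packing and direction compactness *)

Lemma powR_exprn {R : realType} (x s : R) m : 0 <= x -> (x ^+ m) `^ s = (x `^ s) ^+ m.
Proof.
move=> x0; elim: m => [|m IH]; first by rewrite !expr0 powR1.
by rewrite !exprS powRM ?exprn_ge0// IH.
Qed.

Section DigitExpansion.
Context {R : realType}.
Implicit Types u v : R.

Lemma truncn_expnS (N m : nat) u : (0 < N)%N -> 0 <= u ->
  (Num.truncn (u * N%:R ^+ m.+1) %/ N)%N = Num.truncn (u * N%:R ^+ m).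
Proof.
move=> N0 u0; have N0' : 0 < N%:R :> R by rewrite ltr0n.
have t0 : 0 <= u * N%:R ^+ m.+1 by rewrite mulr_ge0// exprn_ge0// ler0n.
have := truncn_itv t0; move: (Num.truncn _) => T /andP[T1 T2].
apply/esym/truncn_def; rewrite exprSr mulrA in T1 T2.
have E := divn_eq T N; have r1 := ltn_pmod T N0.
apply/andP; split.
  rewrite -(ler_pM2r N0'); apply: le_trans T1; rewrite -natrM ler_nat.
  by rewrite {2}E leq_addr.
rewrite -(ltr_pM2r N0'); apply: lt_le_trans T2 _; rewrite -natrM ler_nat.
by rewrite {1}E mulSn addnC -addSn leq_add2r.
Qed.

Lemma truncn_eq_dist (N m : nat) u v : (0 < N)%N -> 0 <= u -> 0 <= v ->
  Num.truncn (u * N%:R ^+ m) = Num.truncn (v * N%:R ^+ m) ->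
  `|u - v| <= (N%:R ^- 1) ^+ m.
Proof.
move=> N0 u0 v0 E; have N0' : 0 < N%:R ^+ m :> R by rewrite exprn_gt0// ltr0n.
have tu : 0 <= u * N%:R ^+ m by rewrite mulr_ge0// ltW.
have tv : 0 <= v * N%:R ^+ m by rewrite mulr_ge0// ltW.
have /andP[u1 u2] := truncn_itv tu; have /andP[v1 v2] := truncn_itv tv.
rewrite E in u1 u2; rewrite -natr1 in u2 v2.
rewrite expr1 exprVn -[X in _ <= X]mul1r ler_pdivlMr//.
rewrite -(gtr0_norm N0') -normrM mulrBl ler_norml.
by apply/andP; split; lra.
Qed.

End DigitExpansion.

Section Packing.
Context {R : realType} {X : metricType R}.
Hypothesis X_complete : complete_space X.
Hypothesis X_geodesic : geodesic_space X.
Hypothesis X_busemann : Busemann_concave X.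
Implicit Types (x y z : X) (a : nat -> X).

(** The first stages of a self-similar Cantor set: at stage [m] the current
    point moves toward one of the points [a 0], ..., [a N.-1], chosen by the
    [m]-th digit of [u] in base [N], covering the fraction [lam ^+ m.+1] of
    the distance. *)
Fixpoint cantor_seq a (N : nat) (lam u : R) (m : nat) : X :=
  if m is m'.+1 then
    geo X_geodesic (cantor_seq a N lam u m')
      (a (Num.truncn (u * N%:R ^+ m) %% N)%N) (lam ^+ m)
  else a 0%N.

Lemma cantor_seq_eq a N lam u v m : (0 < N)%N -> 0 <= u -> 0 <= v ->
  Num.truncn (u * N%:R ^+ m) = Num.truncn (v * N%:R ^+ m) ->
  cantor_seq a N lam u m = cantor_seq a N lam v m.
Proof.
move=> N0 u0 v0; elim: m => [//|m IH] E.
have Em : Num.truncn (u * N%:R ^+ m) = Num.truncn (v * N%:R ^+ m).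
  by rewrite -(truncn_expnS m N0 u0) -(truncn_expnS m N0 v0) E.
by rewrite /= (IH Em) E.
Qed.

(** Contraction toward a point shrinks a separated set only by the expected
    factor (Busemann concavity), so [N] separated points reappear, scaled
    down, around each of their contracted copies.  Iterating produces a Cantor
    set of dimension [ln N / ln (12 D / rho)], coded by base [N] digits. *)
Lemma packing_bound a (N : nat) (D rho s : R) : 0 < s ->
  hausdorff_null s [set: X] -> 0 < rho <= D ->
  (forall i j, (i < N)%N -> (j < N)%N -> mdist (a i) (a j) <= D) ->
  (forall i j, (i < j < N)%N -> rho <= mdist (a i) (a j)) ->
  N%:R <= (12 * D / rho) `^ s.
Proof.
move=> s0 hnull /andP[rho0 rD] aD arho; rewrite leNgt; apply/negP => Nbig.
have D0 : 0 < D by lra.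
pose lam := rho / (12 * D).
have lam0 : 0 < lam by rewrite divr_gt0// mulr_gt0.
have lam1 : lam <= 12^-1 by rewrite ler_pdivrMr ?mulr_gt0//; lra.
have lamD : lam * D = rho / 12 by rewrite /lam; field; rewrite gt_eqF.
have N1 : (1 < N)%N.
  rewrite -(ltr_nat R); apply: le_lt_trans Nbig.
  have one : 1 `^ s = 1 :> R by rewrite powR1.
  have h12 : 1 <= 12 * D / rho by rewrite ler_pdivlMr//; lra.
  have := @ge0_ler_powR R s (ltW s0) 1 (12 * D / rho); rewrite one; apply => //.
    by rewrite nnegrE.
  by rewrite nnegrE; exact: le_trans h12.
have N0 : (0 < N)%N by exact: ltnW.
have N0' : 0 < N%:R :> R by rewrite ltr0n.
have Nlam : N%:R ^- 1 <= lam `^ s.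
  rewrite expr1 -[leRHS]invrK lef_pV2 ?posrE ?invr_gt0 ?powR_gt0//.
  apply: ltW; rewrite -powRN; apply: le_lt_trans Nbig.
  rewrite powRN -powR_inv1 ?powR_ge0// -powRrM mulrC powRrM powR_inv1 ?(ltW lam0)//.
  by rewrite /lam invf_div.
have lamle1 : lam <= 1 by lra.
have le1 m : lam ^+ m.+1 <= 12^-1.
  rewrite exprS; apply: le_trans lam1; rewrite ler_piMr ?(ltW lam0)//.
  by rewrite exprn_ile1// ltW.
have l01 m : 0 <= lam ^+ m.+1 <= 1.
  by rewrite exprn_ge0 ?(ltW lam0)//=; apply: le_trans (le1 m) _; lra.
pose xs := cantor_seq a N lam.
have near0 u m : mdist (a 0%N) (xs u m) <= D * (1 - lam ^+ m).
  elim: m => [|m IH]; first by rewrite expr0 subrr mulr0 mdistxx.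
  rewrite /xs /= -/(xs u m); set j := (_ %% N)%N.
  have jN : (j < N)%N by rewrite ltn_pmod.
  have t1 := metric_triangle (a 0%N) (xs u m) (geo X_geodesic (xs u m) (a j) (lam ^+ m.+1)).
  rewrite mdist_geol ?l01// in t1.
  have t2 := metric_triangle (xs u m) (a 0%N) (a j).
  rewrite (metric_sym (xs u m) (a 0%N)) in t2.
  have t3 := aD 0%N j N0 jN.
  have lm0 : 0 < lam ^+ m by rewrite exprn_gt0.
  have Dl : 0 <= D * lam ^+ m by rewrite mulr_ge0// ltW.
  have t4 : mdist (xs u m) (a j) <= 2 * D by lra.
  have t5 : lam ^+ m.+1 * mdist (xs u m) (a j) <= lam ^+ m.+1 * (2 * D).
    by rewrite ler_pM2l// exprn_gt0.
  have t6 : 3 * (lam * (D * lam ^+ m)) <= D * lam ^+ m.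
    rewrite mulrA ler_piMl//; lra.
  rewrite exprS in t1 t5 *; lra.
have step u m : mdist (xs u m) (xs u m.+1) <= rho / 6 * lam ^+ m.
  rewrite /xs /= -/(xs u m); set j := (_ %% N)%N.
  have jN : (j < N)%N by rewrite ltn_pmod.
  rewrite mdist_geol ?l01//.
  have t2 := metric_triangle (xs u m) (a 0%N) (a j).
  rewrite (metric_sym (xs u m) (a 0%N)) in t2.
  have t3 := aD 0%N j N0 jN; have t4 := near0 u m.
  have lm0 : 0 < lam ^+ m by rewrite exprn_gt0.
  have Dl : 0 <= D * lam ^+ m by rewrite mulr_ge0// ltW.
  have -> : rho / 6 * lam ^+ m = lam ^+ m.+1 * (2 * D).
    have -> : rho / 6 = 2 * (lam * D) by lra.
    by rewrite exprS; ring.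
  by rewrite ler_pM2l ?exprn_gt0//; lra.
have lam01 : 0 <= lam < 1 by apply/andP; split; lra.
have rho6 : 0 <= rho / 6 by rewrite divr_ge0// ltW.
have lim_ex u := geometric_cvg X_complete rho6 lam01 (step u).
have [f hf] := choice lim_ex.
have close u m : mdist (xs u m.+1) (f u) <= rho / 5 * lam ^+ m.+1.
  apply: le_trans (hf u m.+1) _; rewrite ler_pdivrMr; last by lra.
  have lm0 : 0 < lam ^+ m.+1 by rewrite exprn_gt0.
  have r0 : 0 <= rho * lam ^+ m.+1 by rewrite mulr_ge0// ltW.
  have : lam * (rho * lam ^+ m.+1) <= 12^-1 * (rho * lam ^+ m.+1).
    by rewrite ler_wpM2r.
  lra.
pose c := (lam * rho / 2) `^ s.
have c0 : 0 < c by rewrite powR_gt0// divr_gt0// mulr_gt0.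
have holder u v : 0 <= u < 1 -> 0 <= v < 1 -> `|u - v| <= c^-1 * mdist (f u) (f v) `^ s.
  move=> /andP[u0 u1] /andP[v0 v1].
  have [alleq|] := pselect (forall m, Num.truncn (u * N%:R ^+ m) = Num.truncn (v * N%:R ^+ m)).
    apply: (@le_trans _ _ 0); last by rewrite mulr_ge0 ?powR_ge0// invr_ge0 ltW.
    have Ni : (0 : R) <= (N%:R ^- 1 : R) < (1 : R).
      rewrite invr_ge0 expr1 ler0n/= invf_lt1// ltr1n//.
    apply: (le0_geometric (B := 1) Ni) => m.
    by rewrite mul1r; exact: truncn_eq_dist.
  move=> /existsNP hex.
  have hexb : exists m, Num.truncn (u * N%:R ^+ m) != Num.truncn (v * N%:R ^+ m).
    by case: hex => m /eqP; exists m.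
  case: (ex_minnP hexb) => -[|m] neq minm.
    move: neq; rewrite !expr0 !mulr1.
    by rewrite (@truncn_def _ u 0) ?u0// (@truncn_def _ v 0) ?v0// eqxx.
  have eqm : Num.truncn (u * N%:R ^+ m) = Num.truncn (v * N%:R ^+ m).
    by apply/eqP; apply: contraT => /minm; rewrite ltnn.
  apply: le_trans (truncn_eq_dist N0 u0 v0 eqm) _.
  apply: (@le_trans _ _ ((lam `^ s) ^+ m)).
    by rewrite lerXn2r ?nnegrE ?powR_ge0// invr_ge0 exprn_ge0// ltW.
  rewrite mulrC ler_pdivlMr// -powR_exprn ?(ltW lam0)// -powRM ?exprn_ge0 ?(ltW lam0)//; last first.
    by rewrite divr_ge0// mulr_ge0// ltW.
  rewrite ge0_ler_powR ?nnegrE ?mdist_ge0// ?(ltW s0)//.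
    by apply: ltW; rewrite mulr_gt0 ?exprn_gt0 ?divr_gt0// mulr_gt0.
  (* the points agree up to stage m and then move toward distinct points *)
  have sep : lam ^+ m.+1 * rho <= mdist (xs u m.+1) (xs v m.+1).
    rewrite /xs /= (@cantor_seq_eq a N lam u v m)//.
    set i := (_ %% N)%N; set j := (Num.truncn (v * _) %% N)%N.
    have ij : i != j.
      apply: contra neq => /eqP ij; apply/eqP.
      rewrite (divn_eq (Num.truncn (u * N%:R ^+ m.+1)) N) (divn_eq (Num.truncn (v * N%:R ^+ m.+1)) N).
      by rewrite !truncn_expnS// eqm -/i -/j ij.
    have iN : (i < N)%N by rewrite ltn_pmod.
    have jN : (j < N)%N by rewrite ltn_pmod.
    apply: le_trans (geo_contraction X_geodesic X_busemann _ _ _ (l01 m)).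
    rewrite ler_pM2l ?exprn_gt0//.
    move: ij; rewrite neq_ltn => /orP[ij|ij]; first by apply: arho; rewrite ij.
    by rewrite metric_sym; apply: arho; rewrite ij.
  have lr : 0 <= rho * lam ^+ m.+1 by rewrite mulr_ge0 ?(ltW rho0)// exprn_ge0// ltW.
  have cu := close u m; have cv := close v m.
  have t1 := metric_triangle (xs u m.+1) (f u) (xs v m.+1).
  have t2 := metric_triangle (f u) (f v) (xs v m.+1).
  rewrite (metric_sym (f v)) in t2.
  have -> : lam ^+ m * (lam * rho / 2) = lam ^+ m.+1 * rho / 2 by rewrite exprS; field.
  lra.
apply: (@hausdorff_null_interval _ _ (fun u => f (u / 2)) (2 * c^-1) s) => //.
  by rewrite mulr_gt0// invr_gt0.
move=> u v /andP[u0 u1] /andP[v0 v1].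
have hu : 0 <= u / 2 < 1 by apply/andP; split; lra.
have hv : 0 <= v / 2 < 1 by apply/andP; split; lra.
have := holder _ _ hu hv; rewrite -mulrBl normrM (gtr0_norm (x := 2^-1)) ?invr_gt0//.
lra.
Qed.

(** A replacement for the compactness of a space of directions.  Take the points
    at a common small distance from [y] on the geodesics to the [z j].  If no
    geodesic came close to a later point, Busemann concavity would keep these
    points separated, and for large [N] they would violate the packing bound. *)
Lemma direction_compact y (s eta : R) : 0 < s -> hausdorff_null s [set: X] ->
  0 < eta <= 2 ->
  exists N : nat, forall z : nat -> X,
    (forall j, (j < N)%N -> 0 < mdist y (z j)) ->
    (forall i j, (i < j < N)%N -> mdist y (z j) <= mdist y (z i)) ->
    exists i j, (i < j < N)%N /\
      mdist (geo X_geodesic y (z i) (mdist y (z j) / mdist y (z i))) (z j)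
        < eta * mdist y (z j).
Proof.
move=> s0 hnull /andP[eta0 eta2].
pose N := (Num.truncn ((12 * 2 / eta) `^ s)).+1.
exists N => z z0 zle; apply: contrapT => no.
have NN : (N.-1 < N)%N by [].
pose t := mdist y (z N.-1).
have t0 : 0 < t by exact: z0.
pose w j := geo X_geodesic y (z j) (t / mdist y (z j)).
have tz j : (j < N)%N -> t <= mdist y (z j).
  move=> jN; have [jN1|] := ltnP j N.-1; first by apply: zle; rewrite jN1.
  by move=> Nj; rewrite (_ : j = N.-1)//; apply/eqP; rewrite eqn_leq Nj andbT.
have t01 j : (j < N)%N -> 0 <= t / mdist y (z j) <= 1.
  by move=> jN; rewrite divr_ge0 ?(ltW t0) ?mdist_ge0//= ler_pdivrMr ?z0// mul1r tz.
have dw j : (j < N)%N -> mdist y (w j) = t.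
  by move=> jN; rewrite /w mdist_geol ?t01// divfK// gt_eqF ?z0.
have sep i j : (i < j < N)%N -> eta * t <= mdist (w i) (w j).
  move=> /andP[ij jN]; have iN := ltn_trans ij jN.
  have zij : mdist y (z j) <= mdist y (z i) by apply: zle; rewrite ij.
  have far : eta * mdist y (z j) <=
      mdist (geo X_geodesic y (z i) (mdist y (z j) / mdist y (z i))) (z j).
    by rewrite leNgt; apply/negP => h; apply: no; exists i, j; rewrite ij jN.
  (* both geodesics are parametrized to have the length of the second one *)
  have a01 : 0 <= mdist y (z j) / mdist y (z i) <= 1.
    by rewrite divr_ge0 ?mdist_ge0//= ler_pdivrMr ?z0// mul1r.
  have g1 := cs_geodesic_scale a01 (geo_cs X_geodesic y (z i)).
  have h0 : 0 < t / mdist y (z j) by rewrite divr_gt0 ?z0.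
  have /andP[_ h1] := t01 j jN.
  have := X_busemann g1 (geo_cs X_geodesic y (z j)) _ h0 h1 (lexx 1).
  rewrite mulr0 !geo0 mulr1 geo1 => /(_ erefl); rewrite divr1.
  have -> : mdist y (z j) / mdist y (z i) * (t / mdist y (z j)) = t / mdist y (z i).
    by field; rewrite !gt_eqF ?z0.
  rewrite -/(w i) -/(w j) => h; have h2 := le_trans far h.
  rewrite ler_pdivlMr// in h2; apply: le_trans h2.
  by rewrite -mulrA (mulrC (mdist y (z j))) divfK// gt_eqF ?z0.
have wD i j : (i < N)%N -> (j < N)%N -> mdist (w i) (w j) <= 2 * t.
  move=> iN jN; have := metric_triangle (w i) y (w j).
  by rewrite (metric_sym (w i) y) !dw//; lra.
have rr : 0 < eta * t <= 2 * t by rewrite mulr_gt0//= ler_pM2r.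
have := packing_bound s0 hnull rr wD sep.
have -> : 12 * (2 * t) / (eta * t) = 12 * 2 / eta by field; rewrite !gt_eqF.
by rewrite leNgt truncnS_gt.
Qed.

End Packing.

(** * Longer strainers from accumulation and from short geodesics *)

Section Extension.
Context {R : realType} {X : metricType R} {S : R}.
Hypothesis S_ge1 : 1 <= S.
Implicit Types (x y z a b : X) (p q : nat -> X).

(** By [cosang_lt_of_slope], the almost constancy of the distances to the
    [p i] makes the angles with the [p i] almost right.  It extends to the
    [q i], because the sums of both distances are nearly constant. *)
Lemma strainer_extend (kap sig c eps r : R) k x0 x a b p q :
  0 < eps <= c -> S * eps <= kap -> 2 * c <= 1 -> 6 * c < sig ->
  framed eps r k x0 p q -> strainer_cos S kap sig k x p q ->
  mdist x0 x < r / 2 -> mdist x0 a < r / 2 -> mdist x0 b < r / 2 ->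
  strainer1_cos S kap x a b ->
  (forall i, (i < k)%N -> `|mdist (p i) x - mdist (p i) a| <= c * mdist x a /\
     `|mdist (p i) x - mdist (p i) b| <= c * mdist x b) ->
  strained_cos S kap sig k.+1 x.
Proof.
move=> /andP[eps0 epsc] Seps c1 c6 [fr1 fr2 _] [s1 s2 s3] xx xa xb st sl.
have S1 := S_ge1; have [ax bx ba er an] := st.
have rr y : mdist x0 y < r / 2 -> mdist x0 y < r.
  by have := mdist_ge0 x0 y; lra.
have dxa y : mdist x0 y < r / 2 -> mdist x y < r.
  move=> xy; have := metric_triangle x x0 y; rewrite (metric_sym x x0); lra.
have kap0 : 0 < kap by have : 0 < S * eps by [rewrite mulr_gt0//; lra|]; lra.
have cs i e : (i < k)%N -> e != x -> mdist x0 e < r / 2 ->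
    `|mdist (p i) x - mdist (p i) e| <= c * mdist x e ->
    cosang (p i) x e < sig /\ cosang (q i) x e < sig.
  move=> ik ex xe; rewrite ler_norml => /andP[l1 l2].
  have [px qx _ _ _] := s1 i ik.
  have [f1 f2] := fr1 i x ik (rr _ xx).
  have c0 : 0 < c by lra.
  have xer := dxa e xe.
  have h := fr2 i e x ik (rr _ xe) (rr _ xx); rewrite (metric_sym e x) in h.
  have w1 : eps * mdist (p i) x <= c * mdist (p i) x.
    by rewrite ler_wpM2r ?mdist_ge0.
  have w2 : eps * mdist (q i) x <= 2 * c * mdist (q i) x.
    by rewrite ler_wpM2r ?mdist_ge0//; lra.
  have w3 : eps * mdist x e <= c * mdist x e.
    by rewrite ler_wpM2r ?mdist_ge0.
  split.
    apply: (@le_lt_trans _ _ (3 * c)); last by lra.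
    apply: cosang_lt_of_slope => //; first by apply/andP; split; lra.
      by rewrite (metric_sym x (p i)); lra.
    by rewrite (metric_sym x (p i)); lra.
  apply: (@le_lt_trans _ _ (3 * (2 * c))); last by lra.
  apply: cosang_lt_of_slope => //; first by apply/andP; split; lra.
    by rewrite (metric_sym x (q i)); lra.
  by rewrite (metric_sym x (q i)); lra.
exists (fun i => if (i < k)%N then p i else a), (fun i => if (i < k)%N then q i else b).
split.
- by move=> i; case: ifP => [ik _|_ _]; [exact: s1|exact: st].
- move=> i; rewrite ltnS => ik; rewrite ik; case: ifP => [ik1|_]; first exact: s2.
  have [_ f2] := fr1 i x ik (rr _ xx).
  have xar := dxa a xa; rewrite (metric_sym x a) in xar.
  have [_ qx _ _ _] := s1 i ik; have q0 : 0 < mdist (q i) x by rewrite mdist_gt0.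
  have e1 : eps * mdist (q i) x <= 1 * mdist (q i) x by rewrite ler_wpM2r ?mdist_ge0//; lra.
  split; first lra.
  have : (S - 1) * mdist a x <= (S - 1) * (eps * mdist (q i) x).
    by rewrite ler_wpM2l//; lra.
  have : S * eps * mdist (q i) x <= kap * mdist (q i) x by rewrite ler_wpM2r// ltW.
  have : 0 < eps * mdist (q i) x by rewrite mulr_gt0.
  have : 0 < kap * mdist (q i) x by rewrite mulr_gt0.
  lra.
- move=> i j /andP[ij]; rewrite ltnS leq_eqVlt => /orP[/eqP jk|jk].
    have ik : (i < k)%N by rewrite -jk.
    rewrite jk ltnn ik; have [sl1 sl2] := sl i ik.
    by have [? ?] := cs i a ik ax xa sl1; have [? ?] := cs i b ik bx xb sl2.
  by rewrite jk (ltn_trans ij jk); apply: s3; rewrite ij.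
Qed.

(** The point [w] stands for the one on a geodesic from [y] to [a] at the
    distance of [x].  If [x] is close to it, then [x] lies almost on this
    geodesic, so the angle between [a] and [y] at [x] is almost [pi]. *)
Lemma thin_triangle_strainer (kap eta : R) y a x w : 0 < eta <= 4^-1 ->
  4 * eta * S <= kap -> 0 < mdist y x -> mdist y x <= eta * mdist y a ->
  mdist w a = mdist y a - mdist y x -> mdist w x < eta * mdist y x ->
  strainer1_cos S kap x a y.
Proof.
move=> /andP[eta0 eta1] etaS s0 sT wa wx; have S1 := S_ge1.
have t1 := metric_triangle x w a; rewrite (metric_sym x w) (metric_sym x a) in t1.
have t2 := metric_triangle y x a; rewrite (metric_sym x a) in t2.
have T0 : 0 < mdist y a.
  by rewrite -(pmulr_rgt0 _ eta0); lra.
have eT : eta * mdist y a <= 4^-1 * mdist y a by rewrite ler_wpM2r// ltW.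
have es : eta * mdist y x <= 4^-1 * mdist y x by rewrite ler_wpM2r// ltW.
have A0 : 0 < mdist a x by lra.
have eA : eta * mdist y a <= 2 * eta * mdist a x.
  by rewrite -mulrA (mulrCA 2) ler_pM2l//; lra.
have k4 : 4 * eta <= kap by apply: le_trans etaS; rewrite ler_peMr// mulr_ge0// ltW.
split; rewrite -?mdist_gt0//; first lra.
  have : (S - 1) * mdist y x <= (S - 1) * (2 * eta * mdist a x).
    by rewrite ler_wpM2l//; lra.
  have : 4 * eta * S * mdist a x <= kap * mdist a x by rewrite ler_wpM2r// ltW.
  have : 0 < eta * mdist a x by rewrite mulr_gt0.
  have : 0 < kap * mdist a x by rewrite mulr_gt0//; lra.
  have : 0 < S * (eta * mdist a x) by rewrite !mulr_gt0//; lra.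
  lra.
rewrite /cosang (metric_sym x a) (metric_sym x y) (metric_sym a y).
rewrite ltr_pdivrMr ?mulr_gt0//.
move: (mdist y x) (mdist y a) (mdist a x) (mdist w a) (mdist w x) s0 sT wa wx t1 t2 T0 eT es A0 eA => s T A wa' wx' s0 sT wa wx t1 t2 T0 eT es A0 eA.
have h1 : (A + (1 - eta) * s) ^+ 2 <= T ^+ 2.
  by rewrite ler_sqr ?nnegrE; nra.
have h2 : 4 * eta * (A * s) <= kap * (A * s) by rewrite ler_wpM2r// mulr_ge0// ltW.
have h3 : s * (eta * s) <= A * (eta * s).
  by rewrite ler_wpM2r ?mulr_ge0 ?(ltW eta0) ?(ltW s0)//; lra.
have h4 : 0 < eta * (A * s) by rewrite !mulr_gt0.
have h5 : 0 <= (eta * s) ^+ 2 by rewrite sqr_ge0.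
have h6 : 0 <= ((1 - eta) * s) ^+ 2 by rewrite sqr_ge0.
lra.
Qed.

Section Accumulation.
Hypothesis X_complete : complete_space X.
Hypothesis X_geodesic : geodesic_space X.
Hypothesis X_busemann : Busemann_concave X.
Hypothesis X_concave : S_concave S X.

(** Near a strained point, the distances of the strainer separate the points
    that admit no longer strainer.  Otherwise points [z 0, z 1, ...] of this
    kind would converge rapidly to [y], and by compactness of directions some
    [z j] would almost lie on a geodesic from [y] to an earlier [z i], hence
    would be strained by [z i] and [y] in addition. *)
Lemma unstrained_separated (s kap sig c eps r : R) k x0 p q : 0 < s ->
  hausdorff_null s [set: X] ->
  0 < eps <= c -> S * eps <= kap -> 2 * c <= 1 -> 6 * c < sig ->
  framed eps r k x0 p q ->
  (forall y, mdist x0 y < r -> strainer_cos S kap sig k y p q) ->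
  let E := [set y | mdist x0 y < r / 2 /\ ~ strained_cos S kap sig k.+1 y] in
  forall y, E y -> exists2 rho : R, 0 < rho & forall z, E z -> 0 < mdist y z < rho ->
    exists2 i, (i < k)%N & c / 3 * mdist y z < `|mdist (p i) y - mdist (p i) z|.
Proof.
move=> s0 hnull epsc Seps c1 c6 fr nst E y Ey; have S1 := S_ge1.
have /andP[eps0 ec] := epsc.
apply: contrapT => no.
have bad rho : exists z, 0 < rho -> [/\ E z, 0 < mdist y z < rho &
    forall i, (i < k)%N -> `|mdist (p i) y - mdist (p i) z| <= c / 3 * mdist y z].
  have [rho0|] := ltP 0 rho; last by exists y.
  apply: contrapT => no'; apply: no; exists rho => // z Ez yz.
  apply: contrapT => no''; apply: no'; exists z => _; split=> // i ik.
  by rewrite leNgt; apply/negP => h; apply: no''; exists i.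
have [G hG] := choice bad.
have kap0 : 0 < kap by have : 0 < S * eps by [rewrite mulr_gt0//; lra|]; lra.
pose eta := Num.min 4^-1 (kap / (4 * S)).
have eta0 : 0 < eta by rewrite lt_min invr_gt0 ltr0n/= divr_gt0//; lra.
have eta1 : eta <= 4^-1 by rewrite ge_min lexx.
have etaS : 4 * eta * S <= kap.
  have : eta <= kap / (4 * S) by rewrite ge_min lexx orbT.
  by rewrite ler_pdivlMr; lra.
pose z := fix z j := if j is j'.+1 then G (eta * mdist y (z j')) else G 1.
have hz j : [/\ E (z j), 0 < mdist y (z j) & forall i, (i < k)%N ->
    `|mdist (p i) y - mdist (p i) (z j)| <= c / 3 * mdist y (z j)].
  elim: j => [|j [_ IH _]] /=.
    by have [h1 /andP[h2 _] h3] := hG 1 ltr01.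
  by have [h1 /andP[h2 _] h3] := hG _ (mulr_gt0 eta0 IH).
have zS j : mdist y (z j.+1) <= eta * mdist y (z j).
  have [_ IH _] := hz j; have [_ /andP[_ h] _] := hG _ (mulr_gt0 eta0 IH).
  exact: ltW.
have zlt i j : (i < j)%N -> mdist y (z j) <= eta * mdist y (z i).
  elim: j => [//|j IH]; rewrite ltnS leq_eqVlt => /orP[/eqP->//|/IH h].
  apply: le_trans (zS j) _; rewrite ler_pM2l//; apply: le_trans h _.
  by rewrite ler_piMl ?mdist_ge0//; lra.
have e2 : 0 < eta <= 2 by apply/andP; split; lra.
have [N hN] := direction_compact X_complete X_geodesic X_busemann y s0 hnull e2.
have [|i' j' ij|i [j [/andP[ij jN] close]]] := hN z.
- by move=> j _; have [] := hz j.
- have /andP[ij1 _] := ij; apply: le_trans (zlt _ _ ij1) _.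
  by rewrite ler_piMl ?mdist_ge0//; lra.
have [[xi Ei] zi0 sli] := hz i; have [[xj Ej] zj0 slj] := hz j.
have [xy _] := Ey.
have zij := zlt i j ij.
have eT : eta * mdist y (z i) <= 4^-1 * mdist y (z i) by rewrite ler_wpM2r// ltW.
have t01 : 0 <= mdist y (z j) / mdist y (z i) <= 1.
  by rewrite divr_ge0 ?mdist_ge0//= ler_pdivrMr// mul1r; lra.
have wi := mdist_geor X_geodesic y (z i) t01.
rewrite mulrBl mul1r divfK ?gt_eqF// in wi.
have eta01 : 0 < eta <= 4^-1 by rewrite eta0.
have st := thin_triangle_strainer eta01 etaS zj0 zij wi close.
apply: Ej; apply: (strainer_extend epsc Seps c1 c6 fr (nst _ _) xj xi xy st).
  by have := mdist_ge0 x0 (z j); lra.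
have t := metric_triangle y (z j) (z i).
have c30 : 0 <= c by lra.
move=> l lk; have := sli l lk; have := slj l lk.
rewrite (metric_sym (z j) y) !ler_norml => /andP[j1 j2] /andP[i1 i2].
have ct : c / 3 * mdist y (z i) <= c / 2 * mdist (z j) (z i).
  have -> : c / 3 * mdist y (z i) = c * (mdist y (z i) / 3) by ring.
  have -> : c / 2 * mdist (z j) (z i) = c * (mdist (z j) (z i) / 2) by ring.
  by rewrite ler_wpM2l//; lra.
have cj : c / 3 * mdist y (z j) <= c / 2 * mdist (z j) (z i).
  have -> : c / 3 * mdist y (z j) = c * (mdist y (z j) / 3) by ring.
  have -> : c / 2 * mdist (z j) (z i) = c * (mdist (z j) (z i) / 2) by ring.
  by rewrite ler_wpM2l//; lra.
have cy : 0 <= c * mdist y (z j) by rewrite mulr_ge0 ?mdist_ge0.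
by split; apply/andP; split; lra.
Qed.

End Accumulation.

(** Where no strainer longer than [k] exists, the [k] distances of a strainer
    determine the point: on a geodesic between two points with the same
    distances these are almost constant by concavity, so a point [m] of it
    close to one end would be strained by both ends in addition. *)
Lemma strainer_injective (X_geodesic : geodesic_space X) (X_concave : S_concave S X)
    (kap sig c eps r : R) k x0 p q :
  0 < (4 + S) * eps <= c -> S * eps <= kap -> 2 * c <= 1 -> 6 * c < sig ->
  framed eps r k x0 p q ->
  (forall y, mdist x0 y < r -> strainer_cos S kap sig k y p q) ->
  (forall y, ~ strained_cos S kap sig k.+1 y) ->
  forall y z, mdist x0 y < r / 4 -> mdist x0 z < r / 4 ->
  (forall i, (i < k)%N -> mdist (p i) y = mdist (p i) z) -> y = z.
Proof.
move=> /andP[eps0' epsc'] Seps c1 c6 fr nst none y z xy xz fyz.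
have S1 := S_ge1; apply/eqP; apply: contraT => yz; exfalso.
have [fr1 fr2 _] := fr.
have eps0 : 0 < eps by rewrite -(pmulr_rgt0 _ (_ : 0 < 4 + S))//; lra.
have Se0 : 0 < S * eps by rewrite mulr_gt0//; lra.
have ec : eps <= c by lra.
have D0 : 0 < mdist z y by rewrite mdist_gt0 eq_sym.
have kap0 : 0 < kap by lra.
pose eta := Num.min 4^-1 (kap / (4 * S)).
have eta0 : 0 < eta by rewrite lt_min invr_gt0 ltr0n/= divr_gt0//; lra.
have eta1 : eta <= 4^-1 by rewrite ge_min lexx.
have etaS : 4 * eta * S <= kap.
  have : eta <= kap / (4 * S) by rewrite ge_min lexx orbT.
  by rewrite ler_pdivlMr; lra.
have e01 : 0 <= eta <= 1 by apply/andP; split; lra.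
pose m := geo X_geodesic z y eta.
have zm : mdist z m = eta * mdist z y by exact: mdist_geol.
have my : mdist m y = (1 - eta) * mdist z y by exact: mdist_geor.
have Dr := metric_triangle z x0 y; rewrite (metric_sym z x0) in Dr.
have eD : eta * mdist z y <= 4^-1 * mdist z y by rewrite ler_wpM2r// ltW.
have eD0 : 0 < eta * mdist z y by rewrite mulr_gt0.
have t1 := metric_triangle x0 z m.
have xm : mdist x0 m < r / 2 by lra.
have r0 : 0 < r by have := mdist_ge0 x0 y; lra.
have st : strainer1_cos S kap m y z.
  split.
  - by rewrite -mdist_gt0 metric_sym my; lra.
  - by rewrite -mdist_gt0 zm.
  - by rewrite zm (metric_sym y m) my; lra.
  - rewrite zm (metric_sym y m) my.
    have h1 : 4 * eta * S * mdist z y <= kap * mdist z y by rewrite ler_wpM2r// ltW.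
    have h2 : 0 < kap * mdist z y by rewrite mulr_gt0.
    have h3 : kap * (eta * mdist z y) <= kap * (4^-1 * mdist z y) by rewrite ler_pM2l.
    lra.
  - rewrite /cosang (metric_sym m z) my zm (metric_sym y z).
    rewrite ltr_pdivrMr; last by rewrite !mulr_gt0//; lra.
    have : 0 < kap * ((1 - eta) * (eta * mdist z y ^+ 2)).
      by rewrite !mulr_gt0 ?exprn_gt0//; lra.
    lra.
apply: (none m); apply: (strainer_extend (c := c) (r := r) _ Seps c1 c6 fr (nst _ _) xm _ _ st).
- by rewrite eps0.
- by lra.
- by lra.
- by lra.
(* from z toward y, neither distance decreases with more than small slope *)
have gs := geo_cs X_geodesic z y.
have sl e : e != z -> r <= eps * mdist e z ->
    mdist e z - mdist e y <= eps * mdist z y ->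
    mdist e z - (3 + S) * eps * (eta * mdist z y) <= mdist e m.
  move=> ez far de; have e0 : 0 < mdist e z by rewrite mdist_gt0.
  have cs : cosang e z y <= 3 * eps.
    apply: cosang_lt_of_slope => //; first by apply/andP; split; lra.
      by rewrite (metric_sym z e); lra.
    by rewrite (metric_sym z e).
  have := @slope_along _ _ _ S_ge1 X_concave (geo X_geodesic z y) e eta ((3 + S) * eps) gs e01.
  rewrite geo0 geo1; apply => //; first lra.
  have : (S - 1) * mdist z y / (2 * mdist e z) <= S * eps.
    rewrite ler_pdivrMr ?mulr_gt0//.
    have : S * mdist z y <= S * (eps * mdist e z) by rewrite ler_wpM2l//; lra.
    have : 0 <= S * (eps * mdist e z) by rewrite !mulr_ge0 ?mdist_ge0//; lra.
    lra.
  lra.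
move=> i ik; have zr : mdist x0 z < r by lra.
have yr : mdist x0 y < r by lra.
have mr : mdist x0 m < r by lra.
have [far1 far2] := fr1 i z ik zr.
have [g1 _ _] := nst z zr; have [pz qz _ _ _] := g1 i ik.
have h1 := fr2 i z m ik zr mr.
have h2 := fr2 i y z ik yr zr; rewrite (metric_sym y z) fyz// in h2.
have ez : 0 <= eps * mdist z y by rewrite mulr_ge0 ?mdist_ge0// ltW.
have l1 := sl (p i) pz far1; rewrite fyz// subrr in l1; have {}l1 := l1 ez.
have l2 : mdist (q i) z - (3 + S) * eps * (eta * mdist z y) <= mdist (q i) m.
  by apply: sl => //; lra.
rewrite zm in h1.
have sm : `|mdist (p i) m - mdist (p i) z| <= (4 + S) * eps * (eta * mdist z y).
  have w : 0 <= eps * (eta * mdist z y) by rewrite mulr_ge0 ?(ltW eD0)// ltW.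
  by rewrite ler_norml; apply/andP; split; lra.
have cm : (4 + S) * eps * (eta * mdist z y) <= c * (eta * mdist z y).
  by rewrite ler_wpM2r// ltW.
rewrite fyz// (metric_sym m z) zm my; split; last exact: le_trans sm cm.
apply: le_trans (le_trans sm cm) _; rewrite ler_wpM2l//; first by lra.
by lra.
Qed.

End Extension.

(** * Dimension *)

Lemma powR_natXge {R : realType} (T t : R) : 0 < t -> 0 <= T ->
  exists M : nat, (0 < M)%N /\ T <= M%:R `^ t.
Proof.
move=> t0 T0; exists (Num.truncn (T `^ t^-1)).+1; split=> //.
have h : T `^ t^-1 <= (Num.truncn (T `^ t^-1)).+1%:R by exact/ltW/truncnS_gt.
have := @ge0_ler_powR R t (ltW t0) _ _ _ _ h.
rewrite -powRrM mulVf ?gt_eqF// powRr1// => ->//.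
- by rewrite nnegrE powR_ge0.
- by rewrite nnegrE.
Qed.

Lemma card_ffun_powR {R : realType} (M k : nat) :
  #|{ffun 'I_k -> 'I_M}|%:R = M%:R `^ k%:R :> R.
Proof. by rewrite card_ffun !card_ord natrX powR_mulrn. Qed.

Section Grid.
Context {R : realType} {X : metricType R}.
Implicit Types (x y z : X) (f : nat -> X -> R).

(** A set that [k] bounded functions separate with a definite factor is covered
    by [M ^ k] sets of diameter of order [M^-1]. *)
Lemma hausdorff_null_coordinates k (E : set X) f (c B s : R) : 0 < c -> 0 <= B ->
  0 < s -> k%:R < s ->
  (forall i y, (i < k)%N -> E y -> `|f i y| <= B) ->
  (forall y z, E y -> E z -> 0 < mdist y z ->
     exists2 i, (i < k)%N & c * mdist y z <= `|f i y - f i z|) ->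
  hausdorff_null s E.
Proof.
move=> c0 B0 s0 ks fB fE; apply: hausdorff_null_finite => // e e0.
pose L := 2 * B + 1.
have L0 : 0 < L by rewrite /L; lra.
have Lc0 : 0 < (L / c) `^ s by rewrite powR_gt0// divr_gt0.
have sk : 0 < s - k%:R by rewrite subr_gt0.
have [M [M0 hM]] := powR_natXge sk (ltW (divr_gt0 Lc0 e0)).
have M0' : 0 < M%:R :> R by rewrite ltr0n.
pose g i y := Num.truncn ((f i y + B) / L * M%:R).
have g0 i y : (i < k)%N -> E y -> 0 <= (f i y + B) / L * M%:R /\ (g i y < M)%N.
  move=> ik Ey; have := fB i y ik Ey; rewrite ler_norml => /andP[h1 h2].
  have h : 0 <= (f i y + B) / L * M%:R.
    by rewrite mulr_ge0 ?(ltW M0')// divr_ge0 ?(ltW L0)//; lra.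
  split=> //; rewrite -(ltr_nat R) /g.
  have /andP[t1 _] := truncn_itv h; apply: le_lt_trans t1 _.
  by rewrite gtr_pMl// ltr_pdivrMr// mul1r /L; lra.
exists {ffun 'I_k -> 'I_M}, (fun G : {ffun 'I_k -> 'I_M} => E `&` [set y | forall i : 'I_k, g i y = (G i : nat)]), (L / (c * M%:R)).
split.
- move=> y Ey; exists [ffun i : 'I_k => Ordinal (g0 i y (ltn_ord i) Ey).2] => //.
  by split=> // i; rewrite ffunE.
- by rewrite divr_ge0 ?(ltW L0)// mulr_ge0 ?(ltW c0)// ltW.
- move=> G y z [Ey Gy] [Ez Gz].
  have [|d0] := leP (mdist y z) 0.
    by move=> h; apply: le_trans h _; rewrite divr_ge0 ?(ltW L0)// mulr_ge0 ?(ltW c0)// ltW.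
  have [i ik hi] := fE y z Ey Ez d0.
  have [hy _] := g0 i y ik Ey; have [hz _] := g0 i z ik Ez.
  have gyz : g i y = g i z by rewrite (Gy (Ordinal ik)) (Gz (Ordinal ik)).
  have /andP[y1 y2] := truncn_itv hy; have /andP[z1 z2] := truncn_itv hz.
  rewrite -/(g i y) gyz -natr1 in y1 y2; rewrite -/(g i z) -natr1 in z1 z2.
  rewrite ler_pdivlMr ?mulr_gt0// mulrA -ler_pdivlMr//.
  rewrite mulrC; apply: le_trans hi _; rewrite ler_pdivlMr//.
  have ML : 0 < M%:R / L by rewrite divr_gt0.
  have : `|f i y - f i z| * (M%:R / L) <= 1.
    rewrite -[X in _ * X](gtr0_norm ML) -normrM ler_norml.
    have E1 a : (a + B) / L * M%:R = a * (M%:R / L) + B * (M%:R / L).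
      by rewrite mulrDl mulrDl; ring.
    rewrite !E1 in y1 y2 z1 z2; rewrite mulrBl; apply/andP; split; lra.
  by rewrite mulrA ler_pdivrMr// mul1r.
- have Ms : (M%:R^-1) `^ s = M%:R `^ (- s) :> R.
    by rewrite -(powR_inv1 (ltW M0')) -powRrM mulN1r.
  rewrite card_ffun_powR invfM mulrA powRM ?invr_ge0 ?(ltW M0')//; last first.
    by rewrite divr_ge0 ?(ltW L0) ?(ltW c0).
  rewrite Ms mulrCA -powRD; last by apply/implyP; rewrite (gt_eqF M0').
  rewrite (_ : k%:R - s = - (s - k%:R)); last by ring.
  rewrite powRN ler_pdivrMr ?powR_gt0//.
  by rewrite (mulrC e) -ler_pdivrMr.
Qed.

End Grid.

Section Dimension.
Context {R : realType} {X : metricType R} {S : R}.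
Hypothesis S_ge1 : 1 <= S.
Hypothesis X_complete : complete_space X.
Hypothesis X_separable : separable_space X.
Hypothesis X_geodesic : geodesic_space X.
Hypothesis X_concave : S_concave S X.
Hypothesis X_busemann : Busemann_concave X.
Implicit Types (x y z : X) (p q : nat -> X).

(** The grid points of a small cube in [R ^ k] are values of the open map given
    by a strainer, and their preimages violate the packing bound. *)
Lemma strainer_dim k : exists2 eps0 : R, 0 < eps0 <= 1 &
  forall eps r x p q (s : R), 0 < eps <= eps0 -> 0 < r -> framed eps r k x p q ->
    0 < s < k%:R -> ~ hausdorff_null s [set: X].
Proof.
have [eps0 [C [eps01 C0 hopen]]] := framed_open X_complete k.
exists eps0 => // eps r x p q s epsb r0 fr /andP[s0 sk] hnull.
have k0 : 0 < k%:R :> R by exact: lt_trans sk.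
pose tau := r / (2 * C * k%:R).
have tau0 : 0 < tau by rewrite divr_gt0// !mulr_gt0.
have Ctau : C * (k%:R * tau) = r / 2 by rewrite /tau; field; rewrite !gt_eqF.
have ks : 0 < k%:R - s by rewrite subr_gt0.
pose D := r + tau.
have D0 : 0 < D by rewrite addr_gt0.
have K0 : 0 <= (12 * D / tau) `^ s + 1 by rewrite addr_ge0 ?powR_ge0.
have [M [M0 hM]] := powR_natXge ks K0.
have M0' : 0 < M%:R :> R by rewrite ltr0n.
pose v (G : {ffun 'I_k -> 'I_M}) (i : nat) : R :=
  mdist (p i) x + tau / M%:R * (if insub i is Some j then (G j : nat) else 0%N)%:R.
have vE G (i : 'I_k) : v G i = mdist (p i) x + tau / M%:R * (G i)%:R.
  by rewrite /v valK.
have sumv G : C * \sum_(i < k) `|v G i - mdist (p i) x| <= r / 2.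
  rewrite -Ctau ler_pM2l//; apply: (@le_trans _ _ (\sum_(i < k) tau)); last first.
    by rewrite sumr_const card_ord mulr_natl.
  apply: ler_sum => i _; rewrite vE addrAC subrr add0r ger0_norm; last first.
    by rewrite mulr_ge0// divr_ge0 ?(ltW M0')// ltW.
  rewrite mulrAC ler_pdivrMr// ler_pM2l// ler_nat.
  exact/ltnW/ltn_ord.
have sol G : exists z, mdist x z <= r / 2 /\ forall i, (i < k)%N -> mdist (p i) z = v G i.
  have [|z [xz hz]] := hopen eps r x p q epsb fr x (v G).
    by rewrite mdistxx add0r; apply: le_lt_trans (sumv G) _; lra.
  by exists z; split=> //; apply: le_trans xz (sumv G).
have [z hz] := choice sol.
pose N := #|{ffun 'I_k -> 'I_M}|.
pose G0 : {ffun 'I_k -> 'I_M} := [ffun=> Ordinal M0].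
pose a n := z (nth G0 (enum {ffun 'I_k -> 'I_M}) n).
have aD i j : (i < N)%N -> (j < N)%N -> mdist (a i) (a j) <= D.
  move=> _ _; rewrite /a; set A := nth _ _ i; set B := nth _ _ j.
  have := metric_triangle (z A) x (z B); rewrite (metric_sym (z A) x).
  by have [hA _] := hz A; have [hB _] := hz B; rewrite /D; lra.
have asep i j : (i < j < N)%N -> tau / M%:R <= mdist (a i) (a j).
  move=> /andP[ij jN]; have iN := ltn_trans ij jN.
  rewrite /a; set A := nth _ _ i; set B := nth _ _ j.
  have AB : A != B.
    by rewrite /A /B nth_uniq ?enum_uniq ?(ltn_eqF ij)// -cardE.
  have [l hl] : exists l, A l != B l.
    apply: contrapT => no; move/eqP : AB; apply; apply/ffunP => l.
    by apply/eqP; apply: contraT => h; exfalso; apply: no; exists l.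
  have := dist_mdist_le (p l) (z A) (z B).
  have [_ hA] := hz A; have [_ hB] := hz B.
  rewrite (hA l (ltn_ord l)) (hB l (ltn_ord l)) !vE; apply: le_trans.
  rewrite opprD addrACA subrr add0r -mulrBr normrM.
  have tM : 0 < tau / M%:R by rewrite divr_gt0.
  rewrite (gtr0_norm tM); apply: ler_peMr; first exact: ltW.
  move: hl; rewrite -val_eqE neq_ltn => /orP[h|h].
    rewrite ger0_norm ?subr_ge0 ?ler_nat ?(ltnW h)//.
    by rewrite -natrB ?ler1n ?subn_gt0// ltnW.
  rewrite distrC ger0_norm ?subr_ge0 ?ler_nat ?(ltnW h)//.
  by rewrite -natrB ?ler1n ?subn_gt0// ltnW.
have rr : 0 < tau / M%:R <= D.
  rewrite divr_gt0//= ler_pdivrMr//; have : (1 : R) <= M%:R by rewrite ler1n.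
  move=> M1; apply: (@le_trans _ _ D); first by rewrite /D; lra.
  by rewrite ler_peMr// ltW.
have := packing_bound X_complete X_geodesic X_busemann s0 hnull rr aD asep.
rewrite card_ffun_powR.
have -> : 12 * D / (tau / M%:R) = 12 * D / tau * M%:R by field; rewrite !gt_eqF.
rewrite powRM ?(ltW M0')//; last by rewrite divr_ge0 ?(ltW tau0)// mulr_ge0// ltW.
rewrite -ler_pdivrMr ?powR_gt0// -powRB; last by apply/implyP; rewrite gt_eqF.
by move=> h; have := le_trans hM h; rewrite gerDl ler10.
Qed.

(** A point without strainer of length [k.+1] either lacks one of length [k]
    with better constants, or it lies, locally, in a set on which [k] distances
    are bi-Lipschitz coordinates. *)
Lemma unstrained_null k (kap sig s s1 : R) : 0 < kap -> 0 < sig ->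
  0 < s1 -> hausdorff_null s1 [set: X] ->
  0 < s -> k%:R < s + 1 ->
  hausdorff_null s (~` (strained_cos S kap sig k : set X)).
Proof.
move=> + + s10 hnull s0; have S1 := S_ge1.
elim: k kap sig => [|k IH] kap sig kap0 sig0 ks.
  apply: hausdorff_null_subset (hausdorff_null0 s0) => x []; exists (fun=> x), (fun=> x).
  by split=> // i j; rewrite andbC.
rewrite -natr1 in ks.
pose c := Num.min 2^-1 (sig / 7).
have c0 : 0 < c by rewrite lt_min invr_gt0 ltr0n/= divr_gt0.
have c1 : 2 * c <= 1 by have : c <= 2^-1 by [rewrite ge_min lexx]; lra.
have c6 : 6 * c < sig by have : c <= sig / 7 by [rewrite ge_min lexx orbT]; lra.
pose eps := Num.min c (kap / S).
have eps0 : 0 < eps by rewrite lt_min c0 divr_gt0//; lra.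
have epsc : eps <= c by rewrite ge_min lexx.
have Seps : S * eps <= kap.
  have : eps <= kap / S by rewrite ge_min lexx orbT.
  by rewrite ler_pdivlMr; lra.
have epsb : 0 < eps <= 1 by apply/andP; split; lra.
have [kap1 [sig1 [kap10 sig10 hfr]]] := framed_exists S_ge1 X_geodesic X_concave epsb.
pose kap2 := Num.min kap kap1; pose sig2 := Num.min sig sig1.
have kap20 : 0 < kap2 by rewrite lt_min kap0.
have sig20 : 0 < sig2 by rewrite lt_min sig0.
apply: (@hausdorff_null_subset _ _ _ _ (~` (strained_cos S kap2 sig2 k) `|`
    ((strained_cos S kap2 sig2 k : set X) `&` ~` (strained_cos S kap sig k.+1 : set X)))).
  move=> x nx; have [h|h] := pselect (strained_cos S kap2 sig2 k x); [right|left] => //.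
apply: hausdorff_nullU; first by apply: IH => //; lra.
have ksR : k%:R < s by lra.
apply: hausdorff_null_local => // x [[p [q st]] _].
have kk1 : kap2 <= kap1 by rewrite ge_min lexx orbT.
have ss1 : sig2 <= sig1 by rewrite ge_min lexx orbT.
have kk : kap2 <= kap by rewrite ge_min lexx.
have ss : sig2 <= sig by rewrite ge_min lexx.
have [r1 [r10 fr1 _]] := hfr k x p q (strainer_cosW kk1 ss1 st).
have [r2 r20 nst2] := near_radius (near_strainer (strainer_cosW kk ss st)).
pose r := Num.min r1 r2.
have r0 : 0 < r by rewrite lt_min r10.
have rr1 : r <= r1 by rewrite ge_min lexx.
have rr2 : r <= r2 by rewrite ge_min lexx orbT.
have fr := framed_le rr1 fr1.
have nst y : mdist x y < r -> strainer_cos S kap sig k y p q.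
  by move=> xy; apply: nst2; exact: lt_le_trans rr2.
have epsb' : 0 < eps <= c by rewrite eps0.
have sepE := unstrained_separated S_ge1 X_complete X_geodesic X_busemann s10 hnull
  epsb' Seps c1 c6 fr nst.
set E := [set y | _] in sepE.
exists (r / 2); first by rewrite divr_gt0.
apply: (@hausdorff_null_subset _ _ _ _ E); first by move=> y [[_ ny] xy].
pose Em (m : nat) : set X := [set y | E y /\ forall z, E z -> 0 < mdist y z < m.+1%:R^-1 ->
    exists2 i, (i < k)%N & c / 3 * mdist y z < `|mdist (p i) y - mdist (p i) z|].
apply: (@hausdorff_null_subset _ _ _ _ (\bigcup_m Em m)).
  move=> y Ey; have [rho rho0 hrho] := sepE y Ey.
  exists (Num.truncn rho^-1) => //; split=> // z Ez /andP[z0 zr].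
  apply: hrho => //; rewrite z0; apply: lt_trans zr _.
  by rewrite -[ltRHS]invrK ltf_pV2 ?posrE ?invr_gt0// truncnS_gt.
apply: hausdorff_null_bigcup => m; apply: hausdorff_null_local => // y [Ey _].
have m0 : 0 < m.+1%:R^-1 :> R by rewrite invr_gt0 ltr0n.
exists (m.+1%:R^-1 / 2); first by rewrite divr_gt0.
pose B := \sum_(i < k) mdist (p i) x + r.
have c30 : 0 < c / 3 by rewrite divr_gt0.
apply: (@hausdorff_null_coordinates _ _ k _ (fun i => mdist (p i)) (c / 3) B) => //.
- by rewrite addr_ge0 ?(ltW r0)// sumr_ge0// => i _; exact: mdist_ge0.
- move=> i z ik [[[xz _] _] _]; rewrite ger0_norm ?mdist_ge0//.
  apply: le_trans (metric_triangle (p i) x z) _; apply: lerD; last by lra.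
  rewrite (bigD1 (Ordinal ik))//= lerDl sumr_ge0// => j _; exact: mdist_ge0.
- move=> z w [[Ez hz] /= yz] [[Ew _] /= yw] zw0.
  have zw : mdist z w < m.+1%:R^-1.
    have := metric_triangle z y w; rewrite (metric_sym z y).
    by move: (m.+1%:R^-1) yz yw => t yz yw; lra.
  have [|i ik hi] := hz w Ew; first by rewrite zw0.
  by exists i => //; exact: ltW.
Qed.

(** Contraction toward a point of an open set carries every ball into the
    set, so open sets have full dimension. *)
Lemma open_null_all (s : R) (U : set X) : 0 < s -> open U -> U !=set0 ->
  hausdorff_null s U -> hausdorff_null s [set: X].
Proof.
move=> s0 oU [y Uy] hU.
have [r r0 hr] : exists2 r : R, 0 < r & forall z, mdist y z < r -> U z.
  by apply: near_radius; exact: open_nbhs_nbhs.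
apply: (@hausdorff_null_subset _ _ _ _ (\bigcup_n [set z | mdist y z < n.+1%:R])).
  move=> z _; exists (Num.truncn (mdist y z)) => //=.
  exact: truncnS_gt.
apply: hausdorff_null_bigcup => n.
have n0 : 0 < n.+1%:R :> R by rewrite ltr0n.
pose t := Num.min 1 (r / n.+1%:R).
have t0 : 0 < t by rewrite lt_min ltr01 divr_gt0.
have t1 : t <= 1 by rewrite ge_min lexx.
have tn : t * n.+1%:R <= r by rewrite -ler_pdivlMr// ge_min lexx orbT.
have t01 : 0 <= t <= 1 by rewrite ltW.
apply: (@hausdorff_null_expand _ _ _ (fun z => geo X_geodesic y z t) t^-1 s _ U) => //.
- by rewrite invr_gt0.
- move=> z /= yz; apply: hr; rewrite mdist_geol//.
  by apply: lt_le_trans tn; rewrite ltr_pM2l.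
- move=> z w _ _; rewrite mulrC ler_pdivlMr// mulrC.
  exact: geo_contraction.
Qed.

End Dimension.

(** * Charts and the stratification *)

Section Subspaces.
Context {R : realType} {X : metricType R}.

Lemma continuous_set_val (T : topologicalType) (A : set T) :
  continuous (set_val : set_type A -> T).
Proof. exact: initial_continuous. Qed.

Lemma set_type_hausdorff (A : set X) : hausdorff_space (set_type A).
Proof.
move=> u v uv; apply: val_inj; apply: (metric_hausdorff (T := X)) => P Q nP nQ.
have [w [Pw Qw]] := uv (set_val @^-1` P) (set_val @^-1` Q)
  (continuous_set_val nP) (continuous_set_val nQ).
by exists (set_val w).
Qed.

Lemma set_type_second_countable (A : set X) : separable_space X ->
  @second_countable (set_type A).
Proof.
move=> [D cD dD].
pose B (z : X * nat) : set (set_type A) := set_val @^-1` (ball z.1 (z.2.+1%:R^-1 : R))°.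
exists (B @` (D `*` [set: nat])).
  by apply: sub_countable (card_image_le _ _) _; apply: countableX => //; exact: countableP.
split=> [_ [[x m] _ <-]|u P nP].
  by apply: open_comp; [move=> v _; exact: continuous_set_val|exact: open_interior].
move: nP => [_ [[Q oQ <-] /= Qu QP]].
have [r r0 hr] : exists2 r : R, 0 < r & forall z, mdist (set_val u) z < r -> Q z.
  by apply: near_radius; exact: open_nbhs_nbhs.
pose m := Num.truncn (r / 2)^-1.
have m0 : 0 < m.+1%:R^-1 :> R by rewrite invr_gt0 ltr0n.
have hm : m.+1%:R^-1 < r / 2.
  by rewrite -[ltRHS]invrK ltf_pV2 ?posrE ?invr_gt0 ?divr_gt0// truncnS_gt.
have [y [yu Dy]] := dD _ (ex_intro _ (set_val u) (nbhsx_ballx (set_val u) _ m0))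
  (@open_interior _ (ball (set_val u) m.+1%:R^-1)).
move: (interior_subset yu); rewrite ballEmdist/= => {}yu.
have open_ball_mdist (z : X) : (ball z (m.+1%:R^-1 : R))° = [set w | mdist z w < m.+1%:R^-1].
  apply/seteqP; split=> w; first by move/interior_subset; rewrite ballEmdist.
  move=> /= zw; apply/nbhs_ballP; exists (m.+1%:R^-1 - mdist z w); first by rewrite /= subr_gt0.
  move=> w'; rewrite !ballEmdist/= => ww'.
  by apply: le_lt_trans (metric_triangle z w w') _; rewrite -ltrBrDl.
exists (B (y, m)).
  split; first by exists (y, m).
  by rewrite /B /= open_ball_mdist/= metric_sym.
move=> w; rewrite /B /= open_ball_mdist/= => yw; apply: QP => /=; apply: hr.
apply: le_lt_trans (metric_triangle _ y _) _; move: (m.+1%:R^-1) hm yu yw => t *; lra.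
Qed.

(** Only bookkeeping: [F] and [G] are mutually inverse between subsets of [X]
    and [Y], while a homeomorphism is a map between subtypes, here even a
    subtype of a subtype. *)
Lemma homeomorphic_chart (Y : topologicalType) (A U : set X) (V : set Y)
    (F : X -> Y) (G : Y -> X) : U `<=` A -> continuous F ->
  (forall y, U y -> V (F y)) -> (forall v, V v -> U (G v)) ->
  (forall y, U y -> G (F y) = y) -> (forall v, V v -> F (G v) = v) ->
  (forall v (e : R), V v -> 0 < e -> \forall w \near v, V w -> mdist (G v) (G w) < e) ->
  homeomorphic (set_type (set_val @^-1` U : set (set_type A))) (set_type V).
Proof.
move=> UA cF UV VU GF FG cG.
set U' : set (set_type A) := set_val @^-1` U.
have H1 (u : set_type U') : V (F (set_val (set_val u))).
  by apply: UV; exact: (set_valP u).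
have H3 (v : set_type V) : A (G (set_val v)).
  by apply: UA; apply: VU; exact: set_valP.
pose g0 (v : set_type V) : set_type A := exist _ (G (set_val v)) (mem_set (H3 v)).
have H2 (v : set_type V) : U' (g0 v) by rewrite /U' /=; apply: VU; exact: set_valP.
exists (fun u => exist _ (F (set_val (set_val u))) (mem_set (H1 u))),
  (fun v => exist _ (g0 v) (mem_set (H2 v))).
split.
- apply: continuous_comp_initial => u.
  apply: (@continuous_comp _ _ _ (fun u : set_type U' => set_val (set_val u)) F); last exact: cF.
  by apply: (@continuous_comp _ _ _ (set_val : set_type U' -> set_type A) set_val);
    exact: continuous_set_val.
- have cGv : continuous (fun v : set_type V => G (set_val v)); last first.
    by apply: continuous_comp_initial; apply: continuous_comp_initial; exact: cGv.
  move=> v N /nbhs_ballP[e /= e0 hN].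
  have nv := continuous_set_val (cG (set_val v) e (set_valP v) e0).
  apply: (@filterS _ (nbhs v) (nbhs_filter v) _ _ _ nv) => w /= h.
  by apply: hN; rewrite ballEmdist/=; apply: h; exact: set_valP.
- move=> u; apply: val_inj; apply: val_inj => /=; apply: GF.
  exact: (set_valP u).
- by move=> v; apply: val_inj => /=; apply: FG; exact: set_valP.
Qed.

End Subspaces.

Section Coordinates.
Context {R : realType} {X : metricType R}.
Implicit Types (x y z : X) (p q : nat -> X).

Definition dist_map n p x : 'rV[R]_n := \row_i mdist (p i) x.

Lemma continuous_dist_map n p : continuous (dist_map n p : X -> 'rV[R]_n).
Proof.
move=> x; apply/cvg_ballP => e e0.
apply: filterS (nbhsx_ballx x e e0) => y; rewrite ballEmdist/= => xy.
split=> // i j; rewrite !mxE; apply: le_lt_trans xy.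
by rewrite distrC; exact: dist_mdist_le.
Qed.

(** An injective frame is a chart: openness of the frame yields both that the
    image is open and that the inverse is continuous. *)
Lemma frame_chart n (A : set X) (x : X) p (C r rho : R) :
  0 < C -> 0 < rho <= r ->
  (forall y (v : nat -> R), mdist x y + C * \sum_(i < n) `|v i - mdist (p i) y| < r ->
    exists z, mdist y z <= C * \sum_(i < n) `|v i - mdist (p i) y| /\
      forall i, (i < n)%N -> mdist (p i) z = v i) ->
  (forall y z, mdist x y < rho -> mdist x z < rho ->
    (forall i, (i < n)%N -> mdist (p i) y = mdist (p i) z) -> y = z) ->
  (forall y, mdist x y < rho -> A y) ->
  exists2 V : set 'rV[R]_n, open V &
    homeomorphic (set_type (set_val @^-1` [set y | mdist x y < rho] : set (set_type A)))
      (set_type V).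
Proof.
move=> C0 /andP[rho0 rhor] hopen hinj hA.
pose F : X -> 'rV[R]_n := dist_map n p.
pose V : set 'rV[R]_n := [set F y | y in [set y | mdist x y < rho]].
have lift y e : mdist x y < rho -> 0 < e -> \forall w \near F y,
    exists z, [/\ mdist x z < rho, mdist y z < e & F z = w].
  move=> xy e0; pose d := Num.min e (rho - mdist x y).
  have d0 : 0 < d by rewrite lt_min e0 subr_gt0.
  pose t := d / (C * (n%:R + 1)).
  have n1 : 0 < n%:R + 1 :> R by rewrite ltr_wpDl.
  have t0 : 0 < t by rewrite divr_gt0// mulr_gt0.
  apply: filterS (nbhsx_ballx (F y) t t0) => w [_ hw].
  pose v i := if insub i is Some j then w ord0 j else 0.
  have vE (i : 'I_n) : v i = w ord0 i by rewrite /v valK.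
  have sv : C * \sum_(i < n) `|v i - mdist (p i) y| < d.
    apply: (@le_lt_trans _ _ (C * (n%:R * t))).
      rewrite ler_pM2l//; apply: (@le_trans _ _ (\sum_(i < n) t)); last first.
        by rewrite sumr_const card_ord mulr_natl.
      apply: ler_sum => i _; rewrite vE distrC.
      by have := hw ord0 i; rewrite !mxE => /ltW.
    have dE : d = C * ((n%:R + 1) * t) by rewrite /t; field; rewrite !gt_eqF.
    by rewrite [ltRHS]dE ltr_pM2l// ltr_pM2r// ltrDl.
  have sv1 : d <= e by rewrite ge_min lexx.
  have sv2 : d <= rho - mdist x y by rewrite ge_min lexx orbT.
  have [|z [yz hz]] := hopen y v; first by lra.
  exists z; split.
  - by apply: le_lt_trans (metric_triangle x y z) _; lra.
  - by lra.
  - by apply/rowP => i; rewrite mxE hz// vE.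
have G v : {z | V v -> mdist x z < rho /\ F z = v}.
  apply: cid; have [[z xz zv]|no] := pselect (V v); first by exists z.
  by exists x.
have hG v : V v -> mdist x (sval (G v)) < rho /\ F (sval (G v)) = v := svalP (G v).
have Finj y z : mdist x y < rho -> mdist x z < rho -> F y = F z -> y = z.
  move=> xy xz yz; apply: hinj => // i ik.
  by have := congr1 (fun w : 'rV[R]_n => w ord0 (Ordinal ik)) yz; rewrite !mxE.
exists V.
  rewrite openE => _ [y xy <-]; apply: filterS (lift y 1 xy ltr01) => w [z [xz _ zw]].
  by exists z.
apply: (@homeomorphic_chart _ _ _ _ _ _ F (fun v => sval (G v))).
- by move=> y; exact: hA.
- exact: continuous_dist_map.
- by move=> y xy; exists y.
- by move=> v /hG[].
- move=> y xy; have Vy : V (F y) by exists y.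
  by have [xz zy] := hG _ Vy; exact: Finj.
- by move=> v /hG[].
- move=> v e Vv e0; have [xz zv] := hG v Vv.
  have := lift _ e xz e0; rewrite zv; apply: filterS => w [z [xz' yz zw]] Vw.
  have [xw ww] := hG w Vw.
  by rewrite (_ : sval (G w) = z)//; apply: Finj; rewrite // ww.
Qed.

End Coordinates.

Lemma small_angle (R : realType) (kap sig : R) : 0 < kap -> 0 < sig ->
  exists2 d : R, 0 < d < 2^-1 & 1 - cos d <= kap /\ sin d <= sig.
Proof.
move=> k0 s0.
have nc : \forall y \near (0 : R), 1 - kap < cos y.
  have h : 1 - kap < cos (0 : R) by rewrite cos0 gtrBl.
  exact: cvgr_gt (@continuous_cos R 0) _ h.
have ns : \forall y \near (0 : R), sin y < sig.
  have h : sin (0 : R) < sig by rewrite sin0.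
  exact: cvgr_lt (@continuous_sin R 0) _ h.
have [r /= r0 hr] := (@nbhs_ballP R R 0 _).1 (filterI nc ns).
pose d := Num.min (r / 2) 4^-1.
have d0 : 0 < d by rewrite lt_min divr_gt0//= invr_gt0 ltr0n.
have d1 : d <= 4^-1 by rewrite ge_min lexx orbT.
have d2 : d <= r / 2 by rewrite ge_min lexx.
have [|h1 h2] := hr d; first by rewrite /ball /= sub0r normrN gtr0_norm//; lra.
by exists d; [apply/andP; split; lra|split; [lra|exact: ltW]].
Qed.

Section Discreteness.
Context {R : realType} {X : metricType R} {S : R}.
Hypothesis S_ge1 : 1 <= S.
Hypothesis X_complete : complete_space X.
Hypothesis X_geodesic : geodesic_space X.
Hypothesis X_busemann : Busemann_concave X.

(** For strainers of length zero, [unstrained_separated] says that the points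
    without strainer are isolated from each other. *)
Lemma unstrained1_discrete (kap sig s : R) : 0 < kap -> 0 < sig -> 0 < s ->
  hausdorff_null s [set: X] ->
  discrete_set (~` (strained_cos S kap sig 1 : set X)).
Proof.
move=> kap0 sig0 s0 hnull x nx; have S1 := S_ge1.
split; first exact: mem_set.
pose c := Num.min 2^-1 (sig / 7).
have c0 : 0 < c by rewrite lt_min invr_gt0 ltr0n/= divr_gt0.
have c1 : 2 * c <= 1 by have : c <= 2^-1 by [rewrite ge_min lexx]; lra.
have c6 : 6 * c < sig by have : c <= sig / 7 by [rewrite ge_min lexx orbT]; lra.
pose eps := Num.min c (kap / S).
have eps0 : 0 < eps by rewrite lt_min c0 divr_gt0//; lra.
have epsc : 0 < eps <= c by rewrite eps0 ge_min lexx.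
have Seps : S * eps <= kap.
  have : eps <= kap / S by rewrite ge_min lexx orbT.
  by rewrite ler_pdivlMr; lra.
have fr : framed eps 1 0 x (fun=> x) (fun=> x) by [].
have st (y : X) : mdist x y < 1 -> strainer_cos S kap sig 0 y (fun=> x) (fun=> x).
  by move=> _; split=> // i j; rewrite andbC.
have [|rho rho0 hrho] := unstrained_separated S_ge1 X_complete X_geodesic X_busemann
  s0 hnull epsc Seps c1 c6 fr st (y := x).
  by split=> //; rewrite mdistxx.
exists (ball x (Num.min rho (1 / 2))).
  by apply: nbhsx_ballx; rewrite lt_min rho0 divr_gt0.
apply/seteqP; split=> [y []|_ ->]; last first.
  by split=> //; rewrite ballEmdist/= mdistxx lt_min rho0 divr_gt0.
rewrite ballEmdist/= lt_min => /andP[xy1 xy2] ny.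
apply/eqP; rewrite eq_sym; apply: contraT; rewrite -mdist_gt0 => xy0.
by have [//||i] := hrho y; rewrite ?xy0.
Qed.

Lemma strained1_nonempty (kap sig s : R) : 0 < kap -> 0 < sig -> 0 < s ->
  hausdorff_null s [set: X] -> (exists x y : X, x != y) ->
  exists x, strained_cos S kap sig 1 (x : X).
Proof.
move=> kap0 sig0 s0 hnull [x [y xy]]; apply: contrapT => no.
have nx z : (~` (strained_cos S kap sig 1 : set X)) z by move=> h; apply: no; exists z.
have [_ [W /nbhs_ballP[r /= r0 hr] WE]] :=
  unstrained1_discrete kap0 sig0 s0 hnull (nx x).
have D0 : 0 < mdist x y by rewrite mdist_gt0.
pose t := Num.min 1 (r / (2 * mdist x y)).
have t0 : 0 < t by rewrite lt_min ltr01 divr_gt0// mulr_gt0.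
have t01 : 0 <= t <= 1 by rewrite ltW//= ge_min lexx.
have tr : t * mdist x y <= r / 2.
  have : t <= r / (2 * mdist x y) by rewrite ge_min lexx orbT.
  by rewrite ler_pdivlMr ?mulr_gt0//; lra.
have dt := mdist_geol X_geodesic x y t01.
have : [set x] (geo X_geodesic x y t).
  rewrite -WE; split; last exact: nx.
  by apply: hr; rewrite ballEmdist/= dt; lra.
move=> /= E; rewrite E mdistxx in dt.
by have := mulr_gt0 t0 D0; rewrite -dt ltxx.
Qed.

End Discreteness.

Section Assembly.
Context {R : realType} {X : metricType R} {S : R} {n : nat}.
Hypothesis S_ge1 : 1 <= S.
Hypothesis X_complete : complete_space X.
Hypothesis X_geodesic : geodesic_space X.
Hypothesis X_concave : S_concave S X.
Hypothesis X_busemann : Busemann_concave X.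

(** With good enough constants a strainer of length [n] provides a frame for
    which [framed_open] and [strainer_injective] both hold, and these are the
    hypotheses of [frame_chart]. *)
Lemma strained_charts (kapA sigA : R) : 0 < kapA -> 0 < sigA ->
  (forall y : X, ~ strained_cos S kapA sigA n.+1 y) ->
  exists kap sig : R, [/\ 0 < kap, 0 < sig &
    forall kap' sig' : R, kap' <= kap -> sig' <= sig ->
    locally_euclidean R n (set_type (strained_cos S kap' sig' n : set X))].
Proof.
move=> kapA0 sigA0 none; have S1 := S_ge1.
have [epsN [C [/andP[epsN0 epsN1] C0 hopen]]] := framed_open X_complete n.
pose c := Num.min 2^-1 (sigA / 7).
have c0 : 0 < c by rewrite lt_min invr_gt0 ltr0n/= divr_gt0.
have c1 : 2 * c <= 1 by have : c <= 2^-1 by [rewrite ge_min lexx]; lra.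
have c6 : 6 * c < sigA by have : c <= sigA / 7 by [rewrite ge_min lexx orbT]; lra.
pose eps := Num.min epsN (Num.min (c / (4 + S)) (kapA / S)).
have eps0 : 0 < eps by rewrite !lt_min epsN0 !divr_gt0//; lra.
have epsN' : 0 < eps <= epsN by rewrite eps0 ge_min lexx.
have epsc : 0 < (4 + S) * eps <= c.
  have : eps <= c / (4 + S) by rewrite !ge_min lexx !orbT.
  rewrite ler_pdivlMr; last by lra.
  by move=> h; apply/andP; split; [rewrite mulr_gt0//; lra|lra].
have Seps : S * eps <= kapA.
  have : eps <= kapA / S by rewrite !ge_min lexx !orbT.
  by rewrite ler_pdivlMr; lra.
have epsb : 0 < eps <= 1 by have /andP[_ h] := epsN'; apply/andP; split; lra.
have [kapB [sigB [kapB0 sigB0 hfr]]] := framed_exists S_ge1 X_geodesic X_concave epsb.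
exists (Num.min kapA kapB), (Num.min sigA sigB).
split; [by rewrite lt_min kapA0|by rewrite lt_min sigA0|].
move=> kap' sig'; rewrite !le_min => /andP[kA kB] /andP[sA sB].
set A : set X := strained_cos S kap' sig' n.
move=> x; have Ax : A (set_val x) by exact: set_valP.
have [p [q st]] := Ax.
have [r1 [r10 fr1 _]] := hfr _ _ _ _ (strainer_cosW kB sB st).
have [r2 r20 nst2] := near_radius (near_strainer (strainer_cosW kA sA st)).
have [r3 r30 nA] : exists2 r : R, 0 < r & forall y, mdist (set_val x) y < r -> A y.
  by apply: near_radius; apply: open_nbhs_nbhs; split=> //; exact: strained_cos_open.
pose r := Num.min r1 r2.
have r0 : 0 < r by rewrite lt_min r10.
have rr1 : r <= r1 by rewrite ge_min lexx.
have rr2 : r <= r2 by rewrite ge_min lexx orbT.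
have fr := framed_le rr1 fr1.
have nst y : mdist (set_val x) y < r -> strainer_cos S kapA sigA n y p q.
  by move=> xy; apply: nst2; exact: lt_le_trans rr2.
have inj := strainer_injective S_ge1 X_geodesic X_concave epsc Seps c1 c6 fr nst none.
pose rho := Num.min (r / 4) r3.
have rho0 : 0 < rho by rewrite lt_min divr_gt0.
have rho4 : rho <= r / 4 by rewrite ge_min lexx.
have rho3 : rho <= r3 by rewrite ge_min lexx orbT.
have rhor : 0 < rho <= r by apply/andP; split; lra.
have [||V oV hV] := frame_chart (A := A) C0 rhor (hopen eps r (set_val x) p q epsN' fr).
- by move=> y z xy xz; apply: inj; exact: lt_le_trans rho4.
- by move=> y xy; apply: nA; exact: lt_le_trans rho3.
exists (set_val @^-1` [set y | mdist (set_val x) y < rho]), V; split=> //.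
  apply: open_comp; first by move=> v _; exact: continuous_set_val.
  rewrite openE => y /= xy; apply/nbhs_ballP.
  exists (rho - mdist (set_val x) y); first by rewrite /= subr_gt0.
  move=> z; rewrite ballEmdist/= => yz.
  by apply: le_lt_trans (metric_triangle _ y z) _; rewrite -ltrBrDl.
by rewrite /= mdistxx.
Qed.

End Assembly.

Theorem theorem1p4 (R : realType) (X : metricType R) (S : R) (n : nat)
    (S_ge1 : 1 <= S)
    (X_complete : complete_space X)
    (X_separable : separable_space X)
    (X_geodesic : geodesic_space X)
    (X_nontrivial : exists x y : X, x != y)
    (X_concave : S_concave S X)
    (X_busemann : Busemann_concave X)
    (X_dim : hausdorff_dim [set: X] = n%:R%:E) :
  [/\ forall delta : R, 0 < delta < 2^-1 ->
        discrete_set (~` strained X S 1 delta delta),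
      forall delta : R, 0 < delta < 2^-1 ->
        forall k : nat, (1 <= k <= n)%N ->
          (hausdorff_dim (~` strained X S k delta delta) <= k.-1%:R%:E)%E
    & exists X_ : 'I_n.+1 -> set X,
        [/\ \bigcup_(k in [set: 'I_n.+1]) X_ k = [set: X],
            trivIset [set: 'I_n.+1] X_,
            forall k : 'I_n.+1, (hausdorff_dim (X_ k) <= k%:R%:E)%E,
            [/\ open (X_ ord_max), dense (X_ ord_max)
              & topological_manifold R n (set_type (X_ ord_max))]
          & discrete_set (X_ ord0)]].
Proof.
have hnull s : n%:R < s -> hausdorff_null s [set: X] by exact: hausdorff_dim_null.
have n1 : n%:R < n%:R + 1 :> R by rewrite ltrDl.
have n10 : 0 < n%:R + 1 :> R by rewrite ltr_wpDl.
have dpos (d : R) : 0 < d < 2^-1 -> 0 < 1 - cos d /\ 0 < sin d.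
  move=> /andP[d0 d1]; have pi2 := @pi_ge2 R.
  split; last by apply: sin_gt0_pi; apply/andP; split; lra.
  rewrite subr_gt0 -[ltRHS](@cos0 R) ltr_cos ?in_itv/= ?lexx ?pi_ge0//.
  by apply/andP; split; lra.
have unull (d : R) k s : 0 < d < 2^-1 -> 0 < s -> k%:R < s + 1 ->
    hausdorff_null s (~` strained X S k d d).
  move=> d01 s0 ks; have [kap0 sig0] := dpos d d01.
  rewrite strained_cosP//.
  exact: (unstrained_null S_ge1 X_complete X_separable X_geodesic X_concave X_busemann
            kap0 sig0 n10 (hnull _ n1)).
have part1 (d : R) : 0 < d < 2^-1 -> discrete_set (~` strained X S 1 d d).
  move=> d01; have [kap0 sig0] := dpos d d01; rewrite strained_cosP//.
  exact: (unstrained1_discrete S_ge1 X_complete X_geodesic X_busemann kap0 sig0 n10 (hnull _ n1)).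
have part2 (d : R) k : 0 < d < 2^-1 ->
    (hausdorff_dim (~` strained X S k.+1 d d) <= k%:R%:E)%E.
  move=> d01; apply: hausdorff_dim_le => // s ks.
  by apply: unull => //; [exact: le_lt_trans ks|rewrite -natr1 ltrD2r].
split=> //; first by move=> d d01 [|k] // _; exact: part2.
have [epsD epsD01 hD] := strainer_dim X_complete X_geodesic X_busemann n.+1.
have [kapA [sigA [kapA0 sigA0 hfrA]]] := framed_exists S_ge1 X_geodesic X_concave epsD01.
have none (y : X) : ~ strained_cos S kapA sigA n.+1 y.
  move=> [p [q st]]; have [r [r0 fr _]] := hfrA _ _ _ _ st.
  have /andP[epsD0 _] := epsD01.
  have epsDD : 0 < epsD <= epsD by rewrite epsD0 lexx.
  have nn : n%:R < n%:R + 2^-1 :> R by rewrite ltrDl invr_gt0.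
  apply: (hD epsD r y p q (n%:R + 2^-1) epsDD r0 fr _ (hnull _ nn)).
  have nR : (0 : R) <= n%:R by [].
  by rewrite -(natr1 n); apply/andP; split; lra.
have n0 : (0 < n)%N.
  rewrite lt0n; apply/negP => /eqP nz; rewrite nz in none.
  have [x sx] := strained1_nonempty S_ge1 X_complete X_geodesic X_busemann kapA0 sigA0
    n10 (hnull _ n1) X_nontrivial.
  exact: none sx.
have [kap [sig [kap0 sig0 charts]]] :=
  strained_charts S_ge1 X_complete X_geodesic X_concave kapA0 sigA0 none.
have [d d01 [dkap dsig]] := small_angle kap0 sig0.
pose A k := strained X S k d d.
have AE k : A k = strained_cos S (1 - cos d) (sin d) k by exact: strained_cosP.
have A0 x : A 0%N x by exists (fun=> x), (fun=> x).
have Adec k l : (k <= l)%N -> A l `<=` A k.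
  move=> /subnK <-; elim: (l - k)%N => [//|m IH]; apply: subset_trans IH.
  by rewrite addSn !AE; exact: strained_cosS.
pose X_ (k : 'I_n.+1) : set X := A k `&` [set x | (k < n)%N -> ~ A k.+1 x].
have Xmax : X_ ord_max = A n.
  by apply/seteqP; split => [x []//|x Ax]; split=> //=; rewrite ltnn.
have X0 : X_ ord0 = ~` A 1%N.
  by apply/seteqP; split => [x [_ /= /(_ n0)]|x nx]//; split.
exists X_; split.
- apply/seteqP; split=> // x _.
  have exA : exists k, (k <= n)%N && `[<A k x>] by exists 0%N; rewrite leq0n; apply/asboolP.
  have bA k : (k <= n)%N && `[<A k x>] -> (k <= n)%N by case/andP.
  case: (ex_maxnP exA bA) => k /andP[kn /asboolP Ak] kmax.
  exists (Ordinal (n := n.+1) (m := k) kn) => //; split=> //= kltn Ak1.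
  have := kmax k.+1; rewrite ltnn kltn => h; suff : false by [].
  by apply: h; apply/asboolP.
- apply/trivIsetP => i j _ _ ij.
  wlog ltij : i j ij / (i < j)%N => [hw|].
    move: (ij); rewrite -val_eqE neq_ltn => /orP[h|h]; first exact: hw.
    by rewrite setIC; apply: hw => //; rewrite eq_sym.
  apply/seteqP; split=> // x [[_ /= nA] [Aj _]].
  apply: nA; first by apply: leq_trans ltij _; rewrite -ltnS.
  exact: Adec ltij _ Aj.
- move=> k; have [kn|nk] := ltnP k n.
    apply: hausdorff_dim_le => // s ks.
    apply: (@hausdorff_null_subset _ _ _ _ (~` A k.+1)); first by move=> x [_ /(_ kn)].
    by apply: unull => //; [exact: le_lt_trans ks|rewrite -natr1 ltrD2r].
  apply: hausdorff_dim_le => // s ks.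
  apply: hausdorff_null_subset (hnull s _) => //.
  by apply: le_lt_trans ks; rewrite ler_nat.
- rewrite Xmax AE; split.
  + exact: strained_cos_open.
  + move=> O O0 oO; apply: contrapT => no.
    have nO : O `<=` ~` A n by move=> x Ox Ax; apply: no; exists x; split; rewrite -?AE.
    have nR : (1 : R) <= n%:R by rewrite ler1n.
    have s0 : 0 < n%:R - 2^-1 :> R by lra.
    have sn : n%:R < n%:R - 2^-1 + 1 :> R by lra.
    have nullO := hausdorff_null_subset nO (unull d n _ d01 s0 sn).
    have nullX := open_null_all X_geodesic X_busemann s0 oO O0 nullO.
    have : (hausdorff_dim [set: X] <= (n%:R - 2^-1)%:E)%E.
      apply: ereal_inf_lbound; exists (n%:R - 2^-1) => //; split=> //.
      exact: hausdorff_null_measure.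
    by rewrite X_dim lee_fin; lra.
  + split; [exact: set_type_hausdorff|exact: set_type_second_countable|].
    exact: charts.
- by rewrite X0; exact: part1.
Qed.
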